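(* Let $q\geq 5$ be odd. For all $0<\alpha\leq\beta\leq 1$, \[ \operatorname*{w^*\text{-}lim}_{n\to\infty}\Big(\log(n)\cdot m\big|_{F_q^{-n}([\alpha,\beta])}\Big)=\log(\beta/\alpha)\, m , \] i.e. for every continuous $f\colon[0,1]\to\mathbb{R}$ we have $\log(n)\int_{F_q^{-n}([\alpha,\beta])} f\,dm \to \log(\beta/\alpha)\int_{[0,1]} f\,dm$ as $n\to\infty$.
   Context: Setup. Let $q\geq 3$ be odd and $\lambda=\lambda_q=2\cos(\pi/q)$. Elements of $\mathrm{PGL}_2(\mathbb{R})$ are written as matrices $\begin{bmatrix}a&b\\c&d\end{bmatrix}$ (a matrix and its nonzero scalar multiples represent the same element); they act on $\mathbb{R}\cup\{\infty\}$ by $x\mapsto (ax+b)/(cx+d)$, written $g.x$. The Hecke triangle group $\Gamma_q\subset\mathrm{PSL}_2(\mathbb{R})$ is generated by $T=\begin{bmatrix}1&\lambda\\0&1\end{bmatrix}$ and $S=\begin{bmatrix}0&1\\-1&0\end{bmatrix}$. Put $s(x)=\sin(x\pi/q)/\sin(\pi/q)$, $g_k=\begin{bmatrix}s(k)&-s(k+1)\\-s(k-1)&s(k)\end{bmatrix}\in\Gamma_q$ for $k\in\mathbb{Z}$, and $Q=\begin{bmatrix}0&1\\1&0\end{bmatrix}$. Let $K=\{(q+1)/2,\dots,q-1\}$. The generalized Farey map $F_q\colon[0,1]\to[0,1]$ is defined, for $k\in K$, by $F_q(x)=g_k.x$ for $x\in[g_k^{-1}.0,g_k^{-1}.1]$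 and $F_q(x)=Qg_k.x$ for $x\in[(Qg_k)^{-1}.1,(Qg_k)^{-1}.0]$ (these intervals cover $[0,1]$, overlap only at endpoints, and the definitions agree there). $m$ denotes Lebesgue measure on $[0,1]$ and $m|_B$ its restriction to a Borel set $B$. *)

(* Defs.v *)
From HB Require Import structures.
From mathcomp Require Import all_boot all_order all_algebra.
From mathcomp Require Import all_classical all_reals all_analysis.
Set Implicit Arguments. Unset Strict Implicit. Unset Printing Implicit Defensive.
Import Order.TTheory GRing.Theory Num.Theory.
Local Open Scope ring_scope.

Section Hecke.
Variable R : realType.

Definition lam (q : nat) : R := 2 * cos (pi / q%:R).

Definition hs (q : nat) (x : R) : R := sin (x * pi / q%:R) / sin (pi / q%:R).

(* a 2x2 real matrix [[a, b], [c, d]], representing an element of PGL_2(R) *)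
Record M2 := mkM2 { ma : R; mb : R; mc : R; md : R }.

Definition mmul (g h : M2) : M2 :=
  mkM2 (ma g * ma h + mb g * mc h) (ma g * mb h + mb g * md h)
       (mc g * ma h + md g * mc h) (mc g * mb h + md g * md h).

(* inverse in PGL_2(R): the adjugate matrix (a scalar multiple of the inverse) *)
Definition pinv (g : M2) : M2 := mkM2 (md g) (- mb g) (- mc g) (ma g).

Definition act (g : M2) (x : R) : R := (ma g * x + mb g) / (mc g * x + md g).

Definition Tm (q : nat) : M2 := mkM2 1 (lam q) 0 1.
Definition Sm : M2 := mkM2 0 1 (-1) 0.
Definition Qm : M2 := mkM2 0 1 1 0.

Definition gk (q k : nat) : M2 :=
  mkM2 (hs q k%:R) (- hs q (k%:R + 1)) (- hs q (k%:R - 1)) (hs q k%:R).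

Definition Kset (q : nat) : seq nat := [seq k <- iota 0 q | (q.+1./2 <= k)%N].

(* the branches of F_q: (map h, left endpoint, right endpoint) *)
Definition branches (q : nat) : seq (M2 * R * R) :=
  flatten [seq [:: (gk q k, act (pinv (gk q k)) 0, act (pinv (gk q k)) 1);
                   (mmul Qm (gk q k), act (pinv (mmul Qm (gk q k))) 1,
                                      act (pinv (mmul Qm (gk q k))) 0)]
          | k <- Kset q].

(* generalized Farey map F_q on [0,1]: apply the branch whose interval
   contains x (the definitions agree at shared endpoints); junk value x
   outside [0,1] (never used, see farey_preimage). *)
Definition farey (q : nat) (x : R) : R :=
  match [seq b <- branches q | (b.1.2 <= x) && (x <= b.2)] with
  | b :: _ => act b.1.1 x
  | [::] => x
  end.

Definition farey_preimage (q n : nat) (B : set R) : set R :=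
  [set x | x \in `[0, 1]%classic /\ B (iter n (farey q) x)].

End Hecke.

(* Main.v *)
Require Import Defs.
From HB Require Import structures.
From mathcomp Require Import all_boot all_order all_algebra.
From mathcomp Require Import all_classical all_reals all_analysis.
From mathcomp Require Import ring lra zify.
Import Order.TTheory GRing.Theory Num.Theory numFieldNormedType.Exports.
Local Open Scope classical_set_scope.
Local Open Scope ring_scope.

(* The density 1/x is invariant under F_q. Write the density transported by n
   steps as g_n(x)/x; then g_{n+1}(x) is an average of the values of g_n at the
   preimages of x. Nonnegative, nondecreasing, concave functions are preserved by
   this averaging, because the nearly neutral branch at 0 dominates the unfavourable
   terms. For such a starting function, c_n = g_n(1) is nonincreasing, and
   decomposing an orbit according to its last visit to [1/(1 + lambda), 1] gives

     sum_{k<n} g_k(1/(1 + lambda)) tau_{n-1-k} <= I - o(1) <= sum_{k<n} c_k tau_{n-1-k},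

   where I is the total mass, tau_j = O(1/j) and tau_0 + ... + tau_{n-1} =
   log(1 + n lambda). Since c_n - g_n(1/(1 + lambda)) <= (1 + lambda)(c_n - c_{n+1})
   is summable, monotonicity forces c_n -> 0 and then c_n log n -> I. The averaging
   relation propagates this limit to g_n(x) for every x in (0, 1], and integrating
   dx/x yields log(beta/alpha) I. Every polynomial is a difference of two densities of
   this kind, and polynomials are dense in the continuous functions. *)

(** * Calculus on the real line *)

(** Concavity is carried along in order to propagate monotonicity: the inverse branches of Q g_k
    reverse order, and beating them by their increasing partners requires g' to be nonincreasing.
    The asymptotic estimates then work with nonnegative nondecreasing g_n. The oddness q = 2 p + 1
    enters through s(p + 1) = s(p): it makes the two families of weights agree at the last index, so
    that every summation by parts closes without a boundary term. The bound lambda <= 2 enters when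
    the parabolic branch has to dominate in the second derivative. Since dx/x has infinite mass,
    there is no invariant probability density to converge to, and mass leaks towards the neutral
    fixed point 0; this is why a renewal argument replaces contraction. Instead of measures, a
    primitive U_n of g_n(x)/x is followed, updated through its values at the preimages of x; the
    integral over F_q^{-n}([alpha, beta]) is U_n(beta) - U_n(alpha). *)

Lemma is_derive_within_continuous (R : realType) (f df : R -> R) (a b : R) :
  (forall x, a <= x <= b -> is_derive x 1 f (df x)) ->
  {within `[a, b], continuous f}.
Proof.
move=> fdf; apply: derivable_within_continuous => x.
by rewrite in_itv => /= /fdf[].
Qed.

Lemma derive_ge0_le (R : realType) (f df : R -> R) (a b : R) : a <= b ->
  (forall x, a <= x <= b -> is_derive x 1 f (df x)) ->
  (forall x, a <= x <= b -> 0 <= df x) -> f a <= f b.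
Proof.
move=> ab fdf df0.
have [x|c /[!in_itv]/= cab] := @MVT_segment R f df a b ab _ (is_derive_within_continuous _ _ _ _ _ fdf).
  by rewrite in_itv /= => /andP[/ltW ax /ltW xb]; apply: fdf; rewrite ax.
move=> E; rewrite -subr_ge0 E mulr_ge0 ?subr_ge0 //; exact: df0.
Qed.

Lemma is_derive_mobius (R : realType) (a b c d x : R) : c * x + d != 0 ->
  is_derive x 1 (fun y => (a * y + b) / (c * y + d))
    ((a * d - b * c) / (c * x + d) ^+ 2).
Proof.
move=> h.
have D1 : is_derive x 1 (fun y : R => a * y + b) a.
  by apply: is_derive_eq; rewrite /GRing.scale /=; ring.
have D2 : is_derive x 1 (fun y : R => c * y + d) c.
  by apply: is_derive_eq; rewrite /GRing.scale /=; ring.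
have D3 := is_deriveM D1 (@is_deriveV R (fun y : R => c * y + d) x c 1 h D2).
apply: (is_derive_eq D3).
rewrite /GRing.scale /= ; field; exact: h.
Qed.

Lemma is_derive_div_sqr (R : realType) (k c d x : R) : c * x + d != 0 ->
  is_derive x 1 (fun y => k / (c * y + d) ^+ 2)
    (- 2 * k * c / (c * x + d) ^+ 3).
Proof.
move=> h.
have D2 : is_derive x 1 (fun y : R => c * y + d) c.
  by apply: is_derive_eq; rewrite /GRing.scale /=; ring.
have h2 : (c * x + d) ^+ 2 != 0 by rewrite expf_neq0.
have D3 := @is_deriveX R R (fun y : R => c * y + d) 2 x 1 c D2.
have D4 : is_derive x 1 (fun y : R => (c * y + d)^+2) (2 * (c * x + d) * c).
  by apply: (is_derive_eq D3); rewrite /GRing.scale /=; ring.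
have D5 := is_deriveM (is_derive_cst k x 1) (@is_deriveV R (fun y : R => (c * y + d) ^+ 2) x _ 1 h2 D4).
apply: (is_derive_eq D5).
rewrite /GRing.scale /= ; field; exact: h.
Qed.

Lemma is_derive_mul_comp (R : realType) (P h g : R -> R) (x P1 h1 g1 : R) :
  is_derive x 1 P P1 -> is_derive x 1 h h1 -> is_derive (h x) 1 g g1 ->
  is_derive x 1 (fun y => P y * g (h y)) (P1 * g (h x) + P x * (h1 * g1)).
Proof.
move=> DP Dh Dg.
have D := is_deriveM DP (is_derive1_comp Dg Dh).
apply: (is_derive_eq D).
rewrite /GRing.scale /=; ring.
Qed.

Lemma is_derive_bigsum (R : realType) (n : nat) (F : nat -> R -> R) (x : R)
    (dF : nat -> R) : (forall i, (i < n)%N -> is_derive x 1 (F i) (dF i)) ->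
  is_derive x 1 (fun y => \sum_(i < n) F i y) (\sum_(i < n) dF i).
Proof.
move=> h.
have -> : (fun y => \sum_(i < n) F i y) = \sum_(i < n) F i.
  by apply/funext => y; rewrite fct_sumE.
by apply: is_derive_sum => i; apply: h.
Qed.

(** Summation by parts along X 0 <= Y 0 <= X 1 <= Y 1 <= ...: the partial sums of the coefficients
    are be i - al (i+1) after X i and be (i+1) - al (i+1) after Y i, all nonpositive, and the total
    is 0. The induction keeps the last partial sum as coefficient of Y m. *)
Lemma abel_ge0 (R : realDomainType) (al be X Y : nat -> R) (n : nat) :
  (forall i, (i <= n)%N -> be i <= al i) ->
  (forall i, (i < n)%N -> be i <= al i.+1) ->
  (forall i, (i < n)%N -> X i <= Y i) ->
  (forall i, (i.+1 < n)%N -> Y i <= X i.+1) ->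
  al 0%N = be 0%N -> al n = be n ->
  0 <= \sum_(i < n) ((al i - al i.+1) * X i + (be i.+1 - be i) * Y i).
Proof.
move=> h1 h2 h3 h4 e0 en.
case: n h1 h2 h3 h4 en => [|n] h1 h2 h3 h4 en; first by rewrite big_ord0.
suff H m : (m <= n)%N -> - (al m.+1 - be m.+1) * Y m <=
    \sum_(i < m.+1) ((al i - al i.+1) * X i + (be i.+1 - be i) * Y i).
  by apply: le_trans (H n (leqnn n)); rewrite en subrr oppr0 mul0r.
elim: m => [_|m IH mn].
  rewrite big_ord_recl big_ord0 /= addr0 /bump /=.
  have := h3 0%N isT; have := h2 0%N isT; rewrite e0; nra.
rewrite big_ord_recr /=.
have := IH (ltnW mn); set S := \sum_(i < _) _ => HS.
have := h1 m.+1 (ltnW mn); have := h2 m.+1 mn; have := h3 m.+1 mn.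
have := h4 m mn.
nra.
Qed.

Lemma sum_telescope (V : zmodType) (f : nat -> V) (n : nat) :
  \sum_(i < n) (f i - f i.+1) = f 0%N - f n.
Proof.
elim: n => [|n IH]; first by rewrite big_ord0 subrr.
by rewrite big_ord_recr /= IH addrA subrK.
Qed.

(** The open interval matters for [rest_cdf_bounds], where the sign of the derivative is known only
    away from 0. *)
Lemma derive_ge0_le_oo (R : realType) (f df : R -> R) (a b : R) : a <= b ->
  {within `[a, b], continuous f} ->
  (forall x : R, a < x < b -> is_derive x 1 f (df x)) ->
  (forall x : R, a < x < b -> 0 <= df x) -> f a <= f b.
Proof.
rewrite le_eqVlt => /orP[/eqP ->|ab] cf fdf df0; first exact: lexx.
have H x : x \in `]a, b[ -> is_derive x 1 f (df x) by rewrite in_itv; exact: fdf.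
have [c /[!in_itv]/= cab E] := MVT ab H cf.
by rewrite -subr_ge0 E mulr_ge0 ?subr_ge0 ?(ltW ab) // df0.
Qed.

Lemma is_derive_ln_affine (R : realType) (l x : R) : 0 < 1 + l * x ->
  is_derive x 1 (fun y : R => ln (1 + l * y)) (l / (1 + l * x)).
Proof.
move=> h.
have D : is_derive x 1 (fun y : R => 1 + l * y) l.
  by apply: is_derive_eq; rewrite /GRing.scale /=; ring.
have DD := (@is_derive1_comp R (@ln R) (fun y : R => 1 + l * y) x _ _ (is_derive1_ln h) D).
apply: (is_derive_eq DD).
by rewrite mulrC.
Qed.

Lemma ln_dvg (R : realType) (l : R) : 0 < l -> ln (1 + n%:R * l) @[n --> \oo] --> +oo.
Proof.
move=> l0; apply/cvgryPge => A.
have [N HN] : exists N, expR A / l <= N%:R.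
  by exists (Num.truncn (expR A / l)).+1; rewrite ltW // truncnS_gt.
exists N => // n /= Nn; rewrite -[leLHS]expRK ler_ln ?posrE ?expR_gt0 //; last first.
  by rewrite ltr_pwDl // mulr_ge0 // ltW.
rewrite -[leLHS]add0r lerD // -ler_pdivrMr //.
by apply: le_trans HN _; rewrite ler_nat.
Qed.

Lemma ler_pdiv2 (F : realFieldType) (a b c d : F) : 0 < b -> 0 < d ->
  (a / b <= c / d) = (a * d <= c * b).
Proof. by move=> b0 d0; rewrite ler_pdivrMr // mulrAC ler_pdivlMr. Qed.

Lemma affine_gt0l (F : realFieldType) (a b x : F) :
  0 < x -> 1 <= a -> 0 <= b -> 0 < a * x + b.
Proof.
by move=> x0 a1 b0; rewrite ltr_pwDl // mulr_gt0 // (lt_le_trans ltr01).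
Qed.

Lemma affine_gt0r (F : realFieldType) (a b x : F) :
  0 <= x -> 0 <= a -> 1 <= b -> 0 < a * x + b.
Proof.
by move=> x0 a0 b1; rewrite ltr_wpDl ?mulr_ge0 // (lt_le_trans ltr01).
Qed.

(** * A renewal limit theorem *)

Lemma cvg0_of_mul_bounded (R : realType) (c w : nat -> R) (C : R) : 0 < C ->
  (forall n, 0 <= c n) -> (forall n, c n * w n <= C) ->
  w n @[n --> \oo] --> +oo -> c @ \oo --> (0 : R).
Proof.
move=> C0 c_ge0 cw wy.
apply/cvgrPdist_le => e e0.
have /cvgryPge/(_ (C / e)) := wy => -[N0 _ HN].
exists N0 => // n /HN /=; move=> wn.
rewrite sub0r normrN ger0_norm //.
have w0 : 0 < w n by apply: lt_le_trans wn; rewrite divr_gt0.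
have : c n <= C / w n by rewrite ler_pdivlMr.
move/le_trans; apply.
by rewrite ler_pdivrMr // mulrC -ler_pdivrMr.
Qed.

Section Renewal.
(** In the application [c n] and [b n] are g_n(1) and g_n(1/(1 + lambda)), [pi0] is the weight 1/(1
    + lambda) of the parabolic branch at 1, and [I - v N] is the mass that meets [1/(1 + lambda), 1]
    before time N. *)
Variables (R : realType) (c b tau v : nat -> R) (I pi0 : R).
Hypothesis c_ge0 : forall n, 0 <= c n.
Hypothesis c_noninc : forall m n, (m <= n)%N -> c n <= c m.
Hypothesis b_le_c : forall n, b n <= c n.
Hypothesis pi0_gt0 : 0 < pi0.
Hypothesis c_drop : forall n, pi0 * (c n - b n) <= c n - c n.+1.
Hypothesis tau_ge0 : forall n, 0 <= tau n.
Hypothesis tau_noninc : forall m n, (m <= n)%N -> tau n <= tau m.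
Hypothesis tau_le : forall n, tau n.+1 <= n.+1%:R^-1.
Hypothesis tau_div : (\sum_(0 <= k < n) tau k) @[n --> \oo] --> +oo.
Hypothesis v_cvg0 : v @ \oo --> 0.
Hypothesis renewal_lower : forall N,
  \sum_(0 <= k < N) b k * tau (N.-1 - k)%N <= I - v N.
Hypothesis renewal_upper : forall N,
  I - v N <= \sum_(0 <= k < N) c k * tau (N.-1 - k)%N.

Let w n := \sum_(0 <= k < n) tau k.

(** Used with M = 0 for the upper bound on c N * w N and with M = N for the second half of the
    window [0, 2N). *)
Lemma sum_rev_tau (N M : nat) :
  \sum_(M <= k < M + N) tau ((M + N).-1 - k)%N = w N.
Proof.
rewrite -[X in \sum_(X <= _ < _) _]add0n big_addn addKn.
rewrite /w big_nat_rev /= add0n; apply: eq_big_nat => k kN.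
by congr tau; lia.
Qed.

Lemma renewal_gap_sum (M N : nat) : (M <= N)%N ->
  \sum_(M <= k < N) (c k - b k) <= c M / pi0.
Proof.
move=> MN; rewrite ler_pdivlMr // mulrC mulr_sumr.
apply: (@le_trans _ _ (\sum_(M <= k < N) (c k - c k.+1))).
  by apply: ler_sum => k _.
suff -> : \sum_(M <= k < N) (c k - c k.+1) = c M - c N by rewrite gerBl.
rewrite -[RHS]opprB -telescope_sumr // -sumrN.
by apply: eq_bigr => k _; rewrite opprB.
Qed.

(** Replacing b by c costs a sum of gaps c - b, cut at M: for k < M the lag is at least M, so
    [tau M] is the small factor; for k >= M it is the tail of the summable gaps, at most c M /
    pi0. *)
Lemma renewal_gap (M N : nat) : (M + M <= N)%N ->
  \sum_(0 <= k < N) c k * tau (N.-1 - k)%N <=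
  I - v N + (tau M * c 0%N + tau 0%N * c M) / pi0.
Proof.
move=> MN.
have -> : \sum_(0 <= k < N) c k * tau (N.-1 - k)%N =
    \sum_(0 <= k < N) b k * tau (N.-1 - k)%N +
    \sum_(0 <= k < N) (c k - b k) * tau (N.-1 - k)%N.
  by rewrite -big_split /=; apply: eq_bigr => k _; ring.
apply: lerD; first exact: renewal_lower.
rewrite (@big_cat_nat _ _ _ M) //=; last by lia.
rewrite mulrDl; apply: lerD.
  apply: (@le_trans _ _ (\sum_(0 <= k < M) (c k - b k) * tau M)).
    apply: ler_sum_nat => k kM.
    by rewrite ler_wpM2l ?subr_ge0 // tau_noninc //; lia.
  by rewrite -mulr_suml -mulrA [tau M * _]mulrC ler_wpM2r // renewal_gap_sum.
apply: (@le_trans _ _ (\sum_(M <= k < N) (c k - b k) * tau 0%N)).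
  apply: ler_sum_nat => k kM.
  by rewrite ler_wpM2l ?subr_ge0 // tau_noninc.
by rewrite -mulr_suml -mulrA [tau 0 * _]mulrC ler_wpM2r // renewal_gap_sum; lia.
Qed.

Lemma renewal_mul_le (N : nat) : c N * w N <= \sum_(0 <= k < N) c k * tau (N.-1 - k)%N.
Proof.
rewrite -(sum_rev_tau N 0) add0n mulr_sumr; apply: ler_sum_nat => k kN.
by rewrite ler_wpM2r // c_noninc //; lia.
Qed.

(** The crude choice M = 0 in [renewal_gap] already bounds c N * w N, and w diverges. The sharper
    choice M = N/2 gives a vanishing error only once this limit is known. *)
Lemma renewal_cvg0 : c @ \oo --> (0 : R).
Proof.
have [K K0 vK] : exists2 K, 0 <= K & forall N, - v N <= K.
  have /cvg_seq_bounded/pinfty_ex_gt0 [K K0 H] : cvgn v by apply/cvg_ex; exists 0.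
  exists K => [|N]; first exact: ltW.
  by apply: le_trans (ler_norm _) _; rewrite normrN; apply: H.
(* For M = 0 both error terms of [renewal_gap] equal tau 0 * c 0 / pi0; the final 1 only makes C
   positive. *)
pose C := `|I| + K + tau 0%N * c 0%N / pi0 *+ 2 + 1.
have C0 : 0 < C.
  have t0 : 0 <= tau 0%N * c 0%N / pi0 by rewrite divr_ge0 ?mulr_ge0 // ltW.
  by rewrite /C ltr_wpDl // !addr_ge0 // mulrn_wge0.
have cw N : c N * w N <= C.
  apply: (le_trans (renewal_mul_le N)); apply: (le_trans (renewal_gap 0 N _)) => //.
  have := vK N; have := ler_norm I.
  rewrite /C mulr2n mulrDl; lra.
exact: cvg0_of_mul_bounded C0 c_ge0 cw tau_div.
Qed.

Lemma renewal_half : (tau n./2 * c 0%N + tau 0%N * c n./2) / pi0 @[n --> \oo] --> (0:R).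
Proof.
have half : (fun n => n./2) @ \oo --> \oo.
  apply/cvgnyPge => A; exists A.*2 => // n /= An; lia.
have tau0 : tau @ \oo --> (0:R).
  rewrite -(cvg_shiftS tau).
  apply: (@squeeze_cvgr _ _ _ _ (fun=> 0) (fun n => n.+1%:R^-1)).
  - by apply: nearW => n; rewrite tau_ge0 tau_le.
  - exact: cvg_cst.
  - exact: cvg_harmonic.
have -> : (0:R) = (0 * c 0%N + tau 0%N * 0) / pi0 by rewrite mul0r mulr0 addr0 mul0r.
apply: cvgMl; apply: cvgD.
  by apply: cvgMl; apply: (cvg_comp _ _ half tau0).
by apply: cvgMr; apply: (cvg_comp _ _ half renewal_cvg0).
Qed.

(* The lower bound compares the renewal inequality at time 2N with c N * w N:
   the terms k < N contribute at most the Cesaro mean of c. *)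
Lemma renewal_limit : c n * w n @[n --> \oo] --> I.
Proof.
rewrite -(cvg_shiftS (fun n => c n * w n)).
apply: (@squeeze_cvgr _ _ _ _ (fun n => I - v (n.+1 + n.+1)%N - arithmetic_mean c n)
  (fun n => I - v n.+1 + (tau n.+1./2 * c 0%N + tau 0%N * c n.+1./2) / pi0)).
- apply: nearW => n; apply/andP; split; last first.
    by apply: (le_trans (renewal_mul_le n.+1)); apply: renewal_gap; lia.
  rewrite lerBlDr; apply: (le_trans (renewal_upper _)).
  rewrite (@big_cat_nat _ _ _ n.+1) //=; last by lia.
  rewrite addrC; apply: lerD.
    rewrite -(sum_rev_tau n.+1 n.+1) mulr_sumr; apply: ler_sum_nat => k kN.
    by rewrite ler_wpM2r // c_noninc //; lia.
  rewrite /arithmetic_mean /= mulr_sumr /series /= .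
  apply: ler_sum_nat => k kN; rewrite mulrC ler_wpM2r //.
  by apply: le_trans (tau_le n); apply: tau_noninc; lia.
- have H : v (n.+1 + n.+1)%N @[n --> \oo] --> (0 : R).
    apply: (@cvg_comp _ _ _ (fun n => (n.+1 + n.+1)%N) v _ \oo) => //.
    by apply/cvgnyPge => A; exists A => // n /= An; lia.
  have := cvgB (cvgB (cvg_cst I) H) (cesaro renewal_cvg0).
  by rewrite !subr0; apply.
- have H : v n.+1 @[n --> \oo] --> (0 : R) by rewrite (cvg_shiftS v).
  have H2 : (tau n.+1./2 * c 0%N + tau 0%N * c n.+1./2) / pi0 @[n --> \oo] --> (0:R).
    rewrite (cvg_shiftS (fun n => (tau n./2 * c 0%N + tau 0%N * c n./2) / pi0)).
    exact: renewal_half.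
  have := cvgD (cvgB (cvg_cst I) H) H2.
  by rewrite subr0 addr0; apply.
Qed.

End Renewal.

(** * The transfer operator and its invariant cone *)



Section Branches.
Variables (R : realType) (p : nat) (s : nat -> R).

(* With [s i] in the role of s(i) = s(q - i), these are the inverses of the branches
   g_k and Q g_k for k = q - 1 - i, so [i = 0] is the parabolic end. Suffixes 1 and 2
   stand for first and second derivatives. *)
Definition br_up (i : nat) (x : R) := (s i.+1 * x + s i) / (s i.+2 * x + s i.+1).
Definition br_down (i : nat) (x : R) := (s i * x + s i.+1) / (s i.+1 * x + s i.+2).

(** The [+ 0] here and the factors [1] and [- 1] below match the statements of [is_derive_mobius]
    and [is_derive_div_sqr]. *)
Definition wA (i : nat) (x : R) := (s i.+1 * x + 0) / (s i.+1 * x + s i).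
Definition wB (i : nat) (x : R) := (s i * x + 0) / (s i * x + s i.+1).
Definition wA1 (i : nat) (x : R) := (s i.+1 * s i) / (s i.+1 * x + s i) ^+ 2.
Definition wB1 (i : nat) (x : R) := (s i.+1 * s i) / (s i * x + s i.+1) ^+ 2.
Definition wA2 (i : nat) (x : R) :=
  - 2 * (s i.+1 * s i) * s i.+1 / (s i.+1 * x + s i) ^+ 3.
Definition wB2 (i : nat) (x : R) :=
  - 2 * (s i.+1 * s i) * s i / (s i * x + s i.+1) ^+ 3.

Definition br_up1 (i : nat) (x : R) := 1 / (s i.+2 * x + s i.+1) ^+ 2.
Definition br_up2 (i : nat) (x : R) := - 2 * 1 * s i.+2 / (s i.+2 * x + s i.+1) ^+ 3.
Definition br_down1 (i : nat) (x : R) := - 1 / (s i.+1 * x + s i.+2) ^+ 2.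
Definition br_down2 (i : nat) (x : R) := - 2 * - 1 * s i.+1 / (s i.+1 * x + s i.+2) ^+ 3.

(* The differences of [wA] and [wB] are the weights x |h'(x)| / h(x) of the inverse
   branches h; [hatT] is the transfer operator acting on x u(x), for u a density. *)
Definition hatT_term (g : R -> R) (i : nat) (x : R) :=
  (wA i x - wA i.+1 x) * g (br_up i x) + (wB i.+1 x - wB i x) * g (br_down i x).

Definition hatT (g : R -> R) (x : R) := \sum_(i < p) hatT_term g i x.

Definition hatT1_term (g g1 : R -> R) (i : nat) (x : R) :=
  ((wA1 i x - wA1 i.+1 x) * g (br_up i x) +
    (wB1 i.+1 x - wB1 i x) * g (br_down i x)) +
   ((wA i x - wA i.+1 x) * br_up1 i x * g1 (br_up i x) +
    (wB i.+1 x - wB i x) * br_down1 i x * g1 (br_down i x)).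

Definition hatT1 (g g1 : R -> R) (x : R) := \sum_(i < p) hatT1_term g g1 i x.

Definition hatT2_term (g g1 g2 : R -> R) (i : nat) (x : R) :=
  ((wA2 i x - wA2 i.+1 x) * g (br_up i x) +
    (wB2 i.+1 x - wB2 i x) * g (br_down i x)) +
   ((2 * (wA1 i x - wA1 i.+1 x) * br_up1 i x +
      (wA i x - wA i.+1 x) * br_up2 i x) * g1 (br_up i x) +
    (2 * (wB1 i.+1 x - wB1 i x) * br_down1 i x +
      (wB i.+1 x - wB i x) * br_down2 i x) * g1 (br_down i x)) +
   ((wA i x - wA i.+1 x) * br_up1 i x ^+ 2 * g2 (br_up i x) +
    (wB i.+1 x - wB i x) * br_down1 i x ^+ 2 * g2 (br_down i x)).

Definition hatT2 (g g1 g2 : R -> R) (x : R) := \sum_(i < p) hatT2_term g g1 g2 i x.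

(** What is retained of the sines for q = 2 p + 1: growth up to the middle index, the symmetry s(p +
    1) = s(q - p - 1) = s(p), determinant 1 of g_k, and lambda = s(2) <= 2. *)
Hypothesis p_gt0 : (0 < p)%N.
Hypothesis s0 : s 0%N = 0.
Hypothesis s1 : s 1%N = 1.
Hypothesis s_mono : forall i, (i <= p)%N -> s i <= s i.+1.
Hypothesis s_end : s p.+1 = s p.
Hypothesis s_det : forall i, (i < p)%N -> s i.+1 ^+ 2 - s i * s i.+2 = 1.
Hypothesis s2_le2 : s 2%N <= 2.

Lemma s_ge1 i : (i <= p)%N -> 1 <= s i.+1.
Proof.
elim: i => [_|i IH ip]; first by rewrite s1.
by apply: le_trans (IH (ltnW ip)) (s_mono i.+1 ip).
Qed.

Lemma s_ge0 i : (i <= p.+1)%N -> 0 <= s i.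
Proof.
case: i => [_|i ip]; first by rewrite s0.
by apply: le_trans (s_ge1 i ip).
Qed.

Lemma s2_ge1 : 1 <= s 2%N. Proof. exact: s_ge1. Qed.

Lemma s_ge_s2 i : (0 < i)%N -> (i <= p)%N -> s 2%N <= s i.+1.
Proof.
elim: i => // -[|i] IH _ ip //.
by apply: le_trans (IH _ (ltnW ip)) (s_mono i.+2 ip).
Qed.

(** Most branch estimates involve three consecutive values c <= b <= a with b^2 - a c = 1; the names
    [c0 cb ba b1 d] used below refer to them. *)
Lemma s_abc i : (i < p)%N ->
  [/\ 0 <= s i, s i <= s i.+1, s i.+1 <= s i.+2, 1 <= s i.+1 &
      s i.+1 ^+ 2 - s i * s i.+2 = 1].
Proof.
move=> ip; split; [| | | |exact: s_det].
- by rewrite s_ge0 // ltnW // ltnS ltnW.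
- exact: s_mono (ltnW ip).
- exact: s_mono ip.
- exact: s_ge1 (ltnW ip).
Qed.

Lemma br_up_den_gt0 i (x : R) : (i < p)%N -> 0 <= x -> 0 < s i.+2 * x + s i.+1.
Proof.
move=> ip x0; apply: affine_gt0r => //; last exact: s_ge1 (ltnW ip).
exact: s_ge0.
Qed.

Lemma br_down_den_gt0 i (x : R) : (i < p)%N -> 0 <= x -> 0 < s i.+1 * x + s i.+2.
Proof.
move=> ip x0; apply: affine_gt0r => //; last exact: s_ge1.
exact: s_ge0 (leqW ip).
Qed.

Lemma wA_den_gt0 i (x : R) : (i <= p)%N -> 0 < x -> 0 < s i.+1 * x + s i.
Proof.
by move=> ip x0; apply: affine_gt0l => //; [exact: s_ge1|exact: s_ge0 (leqW ip)].
Qed.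

Lemma wB_den_gt0 i (x : R) : (i <= p)%N -> 0 <= x -> 0 < s i * x + s i.+1.
Proof.
by move=> ip x0; apply: affine_gt0r => //; [exact: s_ge0 (leqW ip)|exact: s_ge1].
Qed.

Lemma br_up_gt0 i (x : R) : (i < p)%N -> 0 < x -> 0 < br_up i x.
Proof. by move=> /s_abc[c0 cb ba b1 _] x0; rewrite divr_gt0 //; nra. Qed.

Lemma br_up_le1 i (x : R) : (i < p)%N -> 0 < x -> br_up i x <= 1.
Proof.
by move=> /s_abc[c0 cb ba b1 _] x0; rewrite ler_pdivrMr ?mul1r; nra.
Qed.

Lemma br_down_gt0 i (x : R) : (i < p)%N -> 0 < x -> 0 < br_down i x.
Proof. by move=> /s_abc[c0 cb ba b1 _] x0; rewrite divr_gt0 //; nra. Qed.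

Lemma br_down_le1 i (x : R) : (i < p)%N -> 0 <= x -> br_down i x <= 1.
Proof.
by move=> /s_abc[c0 cb ba b1 _] x0; rewrite ler_pdivrMr ?mul1r; nra.
Qed.

(** After cross-multiplication the difference is (1 - x^2) times the determinant. With the next
    order lemma, the preimages of x are sorted as up 0 <= down 0 <= up 1 <= down 1 <= ..., the order
    in which the Abel summation runs. *)
Lemma br_up_le_down i (x : R) : (i < p)%N -> 0 <= x -> x <= 1 -> br_up i x <= br_down i x.
Proof.
move=> /s_abc[c0 cb ba b1 d] x0 x1.
have M0 : 0 < s i.+2 * x + s i.+1 by clear d; nra.
have N0 : 0 < s i.+1 * x + s i.+2 by clear d; nra.
rewrite ler_pdiv2 //.
have : 0 <= (1 - x ^+ 2) * (s i.+1 ^+ 2 - s i * s i.+2) by rewrite d; nra.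
lra.
Qed.

Lemma br_down_le_up i (x : R) : (i.+1 < p)%N -> 0 <= x -> br_down i x <= br_up i.+1 x.
Proof.
move=> ip x0; have [c0 cb ba b1 d] := s_abc i (ltnW ip).
have [_ _ a3 a1 d'] := s_abc i.+1 ip.
have M0 : 0 < s i.+1 * x + s i.+2 by clear d d'; nra.
have N0 : 0 < s i.+3 * x + s i.+2 by clear d d'; nra.
(* The separating point is the common value of [br_down i] and [br_up i.+1] at 0. *)
apply: (@le_trans _ _ (s i.+1 / s i.+2)).
  rewrite ler_pdiv2 //; last lra.
  have : 0 <= x * (s i.+1 ^+2 - s i * s i.+2) by rewrite d mulr1.
  lra.
rewrite ler_pdiv2 //; last lra.
have : 0 <= x * (s i.+2 ^+2 - s i.+1 * s i.+3) by rewrite d' mulr1.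
lra.
Qed.

Lemma wA_sub i (x : R) : (i < p)%N -> 0 < x ->
  wA i x - wA i.+1 x = x / ((s i.+2 * x + s i.+1) * (s i.+1 * x + s i)).
Proof.
move=> /s_abc[c0 cb ba b1 d] x0; rewrite /wA.
have h1 : s i.+2 * x + s i.+1 != 0 by rewrite gt_eqF //; nra.
have h2 : s i.+1 * x + s i != 0 by rewrite gt_eqF //; nra.
(* [field] does not know the determinant identity; inserting b^2 - a c = 1 as a factor makes both
   sides equal as rational functions. The same device recurs below. *)
set D := RHS.
have -> : D = (s i.+1 ^+ 2 - s i * s i.+2) * D by rewrite d mul1r.
by rewrite /D; field; rewrite h1 h2.
Qed.

Lemma wB_sub i (x : R) : (i < p)%N -> 0 < x ->
  wB i.+1 x - wB i x = x / ((s i.+1 * x + s i.+2) * (s i * x + s i.+1)).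
Proof.
move=> /s_abc[c0 cb ba b1 d] x0; rewrite /wB.
have h1 : s i.+1 * x + s i.+2 != 0 by rewrite gt_eqF //; nra.
have h2 : s i * x + s i.+1 != 0 by rewrite gt_eqF //; nra.
set D := RHS.
have -> : D = (s i.+1 ^+ 2 - s i * s i.+2) * D by rewrite d mul1r.
by rewrite /D; field; rewrite h1 h2.
Qed.

Lemma wA_sub_ge0 i (x : R) : (i < p)%N -> 0 < x -> 0 <= wA i x - wA i.+1 x.
Proof.
move=> ip x0; rewrite wA_sub //; have [c0 cb ba b1 d] := s_abc i ip.
by rewrite divr_ge0 ?mulr_ge0 //; nra.
Qed.

Lemma wB_sub_ge0 i (x : R) : (i < p)%N -> 0 < x -> 0 <= wB i.+1 x - wB i x.
Proof.
move=> ip x0; rewrite wB_sub //; have [c0 cb ba b1 d] := s_abc i ip.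
by rewrite divr_ge0 ?mulr_ge0 //; nra.
Qed.

(** * Derivatives of the weights and of the branch slopes *)

Section Derivatives.
Variables (i : nat) (x : R).
Hypothesis x0 : 0 < x.

Lemma is_derive_wA : (i <= p)%N -> is_derive x 1 (wA i) (wA1 i x).
Proof.
move=> ip.
have h : s i.+1 * x + s i != 0 by rewrite gt_eqF // wA_den_gt0 //.
apply: (is_derive_eq (is_derive_mobius _ (s i.+1) 0 _ _ _ h)).
by rewrite /wA1 mul0r subr0.
Qed.

Lemma is_derive_wB : (i <= p)%N -> is_derive x 1 (wB i) (wB1 i x).
Proof.
move=> ip.
have h : s i * x + s i.+1 != 0 by rewrite gt_eqF // wB_den_gt0 // ltW.
apply: (is_derive_eq (is_derive_mobius _ (s i) 0 _ _ _ h)).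
by rewrite /wB1 mul0r subr0 [s i * _]mulrC.
Qed.

Lemma is_derive_wA1 : (i <= p)%N -> is_derive x 1 (wA1 i) (wA2 i x).
Proof.
move=> ip.
by apply: is_derive_div_sqr; rewrite gt_eqF // wA_den_gt0 //.
Qed.

Lemma is_derive_wB1 : (i <= p)%N -> is_derive x 1 (wB1 i) (wB2 i x).
Proof.
move=> ip.
by apply: is_derive_div_sqr; rewrite gt_eqF // wB_den_gt0 // ltW.
Qed.

Lemma is_derive_br_up1 : (i < p)%N -> is_derive x 1 (br_up1 i) (br_up2 i x).
Proof.
move=> ip.
by apply: is_derive_div_sqr; rewrite gt_eqF // br_up_den_gt0 // ltW.
Qed.

Lemma is_derive_br_down1 : (i < p)%N -> is_derive x 1 (br_down1 i) (br_down2 i x).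
Proof.
move=> ip.
by apply: is_derive_div_sqr; rewrite gt_eqF // br_down_den_gt0 // ltW.
Qed.

End Derivatives.

Lemma is_derive_br_up i (x : R) : (i < p)%N -> 0 <= x ->
  is_derive x 1 (br_up i) (br_up1 i x).
Proof.
move=> ip x0; have [_ _ _ _ d] := s_abc i ip.
have h : s i.+2 * x + s i.+1 != 0 by rewrite gt_eqF // br_up_den_gt0 // ltW.
apply: (is_derive_eq (is_derive_mobius _ (s i.+1) (s i) _ _ _ h)).
by rewrite /br_up1 -d expr2.
Qed.

Lemma is_derive_br_down i (x : R) : (i < p)%N -> 0 <= x ->
  is_derive x 1 (br_down i) (br_down1 i x).
Proof.
move=> ip x0; have [_ _ _ _ d] := s_abc i ip.
have h : s i.+1 * x + s i.+2 != 0 by rewrite gt_eqF // br_down_den_gt0 // ltW.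
apply: (is_derive_eq (is_derive_mobius _ (s i) (s i.+1) _ _ _ h)).
by rewrite /br_down1 -d expr2 opprB.
Qed.

Lemma is_derive_hatT (g g1 : R -> R) (x : R) : 0 < x ->
  (forall y : R, 0 < y -> is_derive y 1 g (g1 y)) ->
  is_derive x 1 (hatT g) (hatT1 g g1 x).
Proof.
move=> x0 Dg.
apply: (@is_derive_bigsum R p (hatT_term g) x (hatT1_term g g1 ^~ x)) => i ip.
have DA := is_deriveB (is_derive_wA i x x0 (ltnW ip)) (is_derive_wA i.+1 x x0 ip).
have DB := is_deriveB (is_derive_wB i.+1 x x0 ip) (is_derive_wB i x x0 (ltnW ip)).
have D := is_deriveD
  (is_derive_mul_comp _ _ _ _ _ _ _ _ DA (is_derive_br_up _ _ ip (ltW x0))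
     (Dg _ (br_up_gt0 _ _ ip x0)))
  (is_derive_mul_comp _ _ _ _ _ _ _ _ DB (is_derive_br_down _ _ ip (ltW x0))
     (Dg _ (br_down_gt0 _ _ ip x0))).
apply: (is_derive_eq D) => /=; rewrite /hatT1_term !fctE; ring.
Qed.

Lemma is_derive_hatT1 (g g1 g2 : R -> R) (x : R) : 0 < x ->
  (forall y : R, 0 < y -> is_derive y 1 g (g1 y)) ->
  (forall y : R, 0 < y -> is_derive y 1 g1 (g2 y)) ->
  is_derive x 1 (hatT1 g g1) (hatT2 g g1 g2 x).
Proof.
move=> x0 Dg Dg1.
apply: (@is_derive_bigsum R p (hatT1_term g g1) x (hatT2_term g g1 g2 ^~ x)) => i ip.
have DA := is_deriveB (is_derive_wA i x x0 (ltnW ip)) (is_derive_wA i.+1 x x0 ip).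
have DB := is_deriveB (is_derive_wB i.+1 x x0 ip) (is_derive_wB i x x0 (ltnW ip)).
have DA1 := is_deriveB (is_derive_wA1 i x x0 (ltnW ip)) (is_derive_wA1 i.+1 x x0 ip).
have DB1 := is_deriveB (is_derive_wB1 i.+1 x x0 ip) (is_derive_wB1 i x x0 (ltnW ip)).
have Du := is_deriveM DA (is_derive_br_up1 i x x0 ip).
have Dd := is_deriveM DB (is_derive_br_down1 i x x0 ip).
have D := is_deriveD
  (is_deriveD
  (is_derive_mul_comp _ _ _ _ _ _ _ _ DA1 (is_derive_br_up _ _ ip (ltW x0))
     (Dg _ (br_up_gt0 _ _ ip x0)))
  (is_derive_mul_comp _ _ _ _ _ _ _ _ DB1 (is_derive_br_down _ _ ip (ltW x0))
     (Dg _ (br_down_gt0 _ _ ip x0))))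
  (is_deriveD
  (is_derive_mul_comp _ _ _ _ _ _ _ _ Du (is_derive_br_up _ _ ip (ltW x0))
     (Dg1 _ (br_up_gt0 _ _ ip x0)))
  (is_derive_mul_comp _ _ _ _ _ _ _ _ Dd (is_derive_br_down _ _ ip (ltW x0))
     (Dg1 _ (br_down_gt0 _ _ ip x0)))).
apply: (is_derive_eq D) => /=; rewrite /hatT2_term !fctE /GRing.scale /=; ring.
Qed.

(** * Inequalities between the derivatives of the weights *)

Section Weights.
Variable x : R.
Hypotheses (x0 : 0 < x) (x1 : x <= 1).

Lemma wB_wA_den i : (i <= p)%N -> s i.+1 * x + s i <= s i * x + s i.+1.
Proof.
move=> /s_mono h; rewrite -subr_ge0.
have -> : s i * x + s i.+1 - (s i.+1 * x + s i) = (s i.+1 - s i) * (1 - x) by ring.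
by rewrite mulr_ge0 // subr_ge0.
Qed.

Lemma wB1_le_wA1 i : (i <= p)%N -> wB1 i x <= wA1 i x.
Proof.
move=> ip; have h := wB_wA_den i ip; have hA := wA_den_gt0 i x ip x0.
have hB := wB_den_gt0 i x ip (ltW x0).
rewrite /wB1 /wA1 ler_wpM2l ?mulr_ge0 ?s_ge0 // ?(leqW ip) //.
by rewrite lef_pV2 ?posrE ?exprn_gt0 // lerXn2r // nnegrE ltW.
Qed.

(** This is [wB1_le_wA1S] with the common factor s(i+1) cancelled; multiplied by its first-power
    analogue it also yields [wA2S_le_wB2]. *)
Lemma cross_sqr i : (i < p)%N ->
  s i * (s i.+2 * x + s i.+1) ^+ 2 <= s i.+2 * (s i * x + s i.+1) ^+ 2.
Proof.
move=> ip; have [c0 cb ba b1 d] := s_abc i ip; rewrite -subr_ge0.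
have -> : s i.+2 * (s i * x + s i.+1) ^+ 2 - s i * (s i.+2 * x + s i.+1) ^+ 2 =
  (s i.+2 - s i) * ((s i.+1 ^+ 2 - s i * s i.+2) + s i * s i.+2 * (1 - x ^+ 2)) by ring.
rewrite d mulr_ge0 ?subr_ge0 ?(le_trans cb ba) // addr_ge0 //.
rewrite !mulr_ge0 // ?subr_ge0 ?exprn_ile1 ?(ltW x0) //.
by rewrite (le_trans c0) // (le_trans cb).
Qed.

Lemma wB1_le_wA1S i : (i < p)%N -> wB1 i x <= wA1 i.+1 x.
Proof.
move=> ip; have h := cross_sqr i ip; have [c0 cb ba b1 d] := s_abc i ip.
rewrite /wB1 /wA1 ler_pdiv2 ?exprn_gt0 ?wB_den_gt0 ?wA_den_gt0 ?(ltnW ip) ?(ltW x0) //.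
rewrite -[leLHS]mulrA [s i.+2 * s i.+1]mulrC -[leRHS]mulrA ler_wpM2l //.
exact: le_trans c0 cb.
Qed.

Lemma wA2_le_wB2 i : (i <= p)%N -> wA2 i x <= wB2 i x.
Proof.
move=> ip; have h := wB_wA_den i ip; have hA := wA_den_gt0 i x ip x0.
have hB := wB_den_gt0 i x ip (ltW x0).
have c0 := s_ge0 i (leqW ip); have b1 := s_ge1 i ip; have cb := s_mono i ip.
rewrite /wB2 /wA2 !mulNr lerN2 -!mulrA ler_wpM2l // !mulrA.
rewrite ler_pdiv2 ?exprn_gt0 //.
rewrite -!mulrA ler_wpM2l ?(le_trans c0) // ler_wpM2l //.
have h3 : (s i.+1 * x + s i) ^+ 3 <= (s i * x + s i.+1) ^+ 3.
  by rewrite lerXn2r // nnegrE ltW.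
apply: ler_pM => //; by rewrite exprn_ge0 // ltW.
Qed.

Lemma wA2S_le_wB2 i : (i < p)%N -> wA2 i.+1 x <= wB2 i x.
Proof.
move=> ip; have h := cross_sqr i ip; have [c0 cb ba b1 d] := s_abc i ip.
have hA := br_up_den_gt0 i x ip (ltW x0); have hB := wB_den_gt0 i x (ltnW ip) (ltW x0).
have b0 := le_trans c0 cb; have a0 := le_trans b0 ba.
rewrite /wB2 /wA2 !mulNr lerN2 -!mulrA ler_wpM2l // !mulrA.
rewrite ler_pdiv2 ?exprn_gt0 //.
have h1 : s i * (s i.+2 * x + s i.+1) <= s i.+2 * (s i * x + s i.+1).
  rewrite !mulrDr !mulrA [s i * s i.+2]mulrC lerD2l ler_wpM2r //.
  exact: le_trans ba.
have H : (s i * (s i.+2 * x + s i.+1)) * (s i * (s i.+2 * x + s i.+1) ^+ 2) <=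
  (s i.+2 * (s i * x + s i.+1)) * (s i.+2 * (s i * x + s i.+1) ^+ 2).
  by apply: ler_pM => //; rewrite !mulr_ge0 // ?exprn_ge0 // ltW.
have := ler_wpM2l b0 H.
rewrite [leLHS](_ : _ = s i.+1 * s i * s i * (s i.+2 * x + s i.+1) ^+ 3); last by ring.
by rewrite [leRHS](_ : _ = s i.+2 * s i.+1 * s i.+2 * (s i * x + s i.+1) ^+ 3) //; ring.
Qed.

Lemma wA1_0 : wA1 0 x = wB1 0 x. Proof. by rewrite /wA1 /wB1 s0 mulr0 !mul0r. Qed.
Lemma wA2_0 : wA2 0 x = wB2 0 x.
Proof. by rewrite /wA2 /wB2 s0 mulr0 !(mulr0, mul0r). Qed.
Lemma wA1_p : wA1 p x = wB1 p x. Proof. by rewrite /wA1 /wB1 s_end. Qed.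
Lemma wA2_p : wA2 p x = wB2 p x. Proof. by rewrite /wA2 /wB2 s_end. Qed.

Lemma up_down_den i : (i < p)%N ->
  s i.+2 * x + s i.+1 <= s i.+1 * x + s i.+2.
Proof. exact: wB_wA_den. Qed.

Lemma inv_up_down_den i : (i < p)%N ->
  ((s i.+1 * x + s i.+2) ^+ 3 * (s i * x + s i.+1))^-1 <=
  ((s i.+2 * x + s i.+1) ^+ 3 * (s i.+1 * x + s i))^-1.
Proof.
move=> ip.
have M0 := br_up_den_gt0 i x ip (ltW x0); have N0 := wA_den_gt0 i x (ltnW ip) x0.
have M'0 := br_down_den_gt0 i x ip (ltW x0).
have N'0 := wB_den_gt0 i x (ltnW ip) (ltW x0).
rewrite lef_pV2 ?posrE ?mulr_gt0 ?exprn_gt0 //.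
have h3 : (s i.+2 * x + s i.+1) ^+ 3 <= (s i.+1 * x + s i.+2) ^+ 3.
  by rewrite lerXn2r ?nnegrE ?(ltW M0) ?(ltW M'0) // up_down_den.
apply: ler_pM => //; [by rewrite exprn_ge0 // ltW|exact: ltW|].
exact: wB_wA_den (ltnW ip).
Qed.

(** Up to sign, the coefficients of g' in [hatT1] are x times the two inverse products that
    [inv_up_down_den] compares. *)
Lemma up_atom i : (i < p)%N -> (wA i x - wA i.+1 x) * br_up1 i x =
  x * ((s i.+2 * x + s i.+1) ^+ 3 * (s i.+1 * x + s i))^-1.
Proof.
move=> ip; rewrite wA_sub // /br_up1.
have M0 := br_up_den_gt0 i x ip (ltW x0); have N0 := wA_den_gt0 i x (ltnW ip) x0.
by field; rewrite !gt_eqF.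
Qed.

Lemma down_atom i : (i < p)%N -> (wB i.+1 x - wB i x) * br_down1 i x =
  - (x * ((s i.+1 * x + s i.+2) ^+ 3 * (s i * x + s i.+1))^-1).
Proof.
move=> ip; rewrite wB_sub // /br_down1.
have M'0 := br_down_den_gt0 i x ip (ltW x0).
have N'0 := wB_den_gt0 i x (ltnW ip) (ltW x0).
by field; rewrite !gt_eqF.
Qed.

(** [up_atom2] and [down_atom2] are the coefficients of g' at the two preimages in [hatT2_term]. *)
Definition up_atom2 i := 2 * (wA1 i x - wA1 i.+1 x) * br_up1 i x +
      (wA i x - wA i.+1 x) * br_up2 i x.
Definition down_atom2 i := 2 * (wB1 i.+1 x - wB1 i x) * br_down1 i x +
      (wB i.+1 x - wB i x) * br_down2 i x.

Lemma up_atom2E i : (i < p)%N -> up_atom2 i =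
  2 * ((s i.+2 * x + s i.+1) ^+ 3 * (s i.+1 * x + s i))^-1 *
  (1 - 2 * s i.+2 * x / (s i.+2 * x + s i.+1) - s i.+1 * x / (s i.+1 * x + s i)).
Proof.
move=> ip; have [c0 cb ba b1 d] := s_abc i ip.
have M0 := br_up_den_gt0 i x ip (ltW x0); have N0 := wA_den_gt0 i x (ltnW ip) x0.
rewrite /up_atom2 /wA1 /wA /br_up1 /br_up2.
set D := RHS.
have -> : D = (s i.+1 ^+ 2 - s i * s i.+2) * D by rewrite d mul1r.
by rewrite /D; field; rewrite !gt_eqF.
Qed.

Lemma down_atom2E i : (i < p)%N -> down_atom2 i =
  2 * ((s i.+1 * x + s i.+2) ^+ 3 * (s i * x + s i.+1))^-1 *
  (2 * s i.+1 * x / (s i.+1 * x + s i.+2) + s i * x / (s i * x + s i.+1) - 1).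
Proof.
move=> ip; have [c0 cb ba b1 d] := s_abc i ip.
have M'0 := br_down_den_gt0 i x ip (ltW x0).
have N'0 := wB_den_gt0 i x (ltnW ip) (ltW x0).
rewrite /down_atom2 /wB1 /wB /br_down1 /br_down2.
set D := RHS.
have -> : D = (s i.+1 ^+ 2 - s i * s i.+2) * D by rewrite d mul1r.
by rewrite /D; field; rewrite !gt_eqF.
Qed.

(** Because s(0) = 0, the last fraction in [up_atom2E] equals 1 and cancels the positive part of the
    bracket. This is the special feature of the parabolic branch. *)
Lemma up_atom2_0 : up_atom2 0 = - 4 * s 2%N / (s 2%N * x + 1) ^+ 4.
Proof.
have := br_up_den_gt0 0 x p_gt0 (ltW x0); rewrite s1 => M0.
rewrite up_atom2E // s0 s1; field.
by rewrite !gt_eqF // addr0 mul1r.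
Qed.

Lemma down_atom2_0 : down_atom2 0 <= 0.
Proof.
have M'0 := br_down_den_gt0 0 x p_gt0 (ltW x0).
have N'0 := wB_den_gt0 0 x isT (ltW x0).
rewrite down_atom2E // mulr_ge0_le0 //.
  by rewrite mulr_ge0 // invr_ge0 ltW // mulr_gt0 // exprn_gt0.
rewrite s0 !mul0r addr0 subr_le0 ler_pdivrMr //.
have := s2_ge1; move: x1; rewrite s1; lra.
Qed.

Lemma up_atom2_le i : (i < p)%N ->
  up_atom2 i <= 2 * ((s i.+2 * x + s i.+1) ^+ 3 * (s i.+1 * x + s i))^-1.
Proof.
move=> ip; have [c0 cb ba b1 d] := s_abc i ip.
have b0 := le_trans c0 cb; have a0 := le_trans b0 ba.
have M0 := br_up_den_gt0 i x ip (ltW x0); have N0 := wA_den_gt0 i x (ltnW ip) x0.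
rewrite up_atom2E //; set k := 2 * _.
rewrite -[leRHS]mulr1 ler_wpM2l //.
  by rewrite mulr_ge0 // invr_ge0 ltW // mulr_gt0 // exprn_gt0.
have h1 : 0 <= 2 * s i.+2 * x / (s i.+2 * x + s i.+1).
  by rewrite divr_ge0 ?mulr_ge0 // ltW.
have h2 : 0 <= s i.+1 * x / (s i.+1 * x + s i).
  by rewrite divr_ge0 ?mulr_ge0 // ltW.
lra.
Qed.

(** In [down_atom2E] the first fraction is at most 1, by s(i+1) x <= s(i+2), and the second at most
    1/2, by s(i) x <= s(i+1), so the bracket is at most 1/2. *)
Lemma down_atom2_le i : (i < p)%N ->
  down_atom2 i <= ((s i.+2 * x + s i.+1) ^+ 3 * (s i.+1 * x + s i))^-1.
Proof.
move=> ip; apply: le_trans (inv_up_down_den i ip).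
have [c0 cb ba b1 d] := s_abc i ip.
have b0 := le_trans c0 cb; have a0 := le_trans b0 ba.
have M'0 := br_down_den_gt0 i x ip (ltW x0).
have N'0 := wB_den_gt0 i x (ltnW ip) (ltW x0).
rewrite down_atom2E //; set k := _^-1.
have k0 : 0 <= k by rewrite invr_ge0 ltW // mulr_gt0 // exprn_gt0.
have h1 : 2 * s i.+1 * x / (s i.+1 * x + s i.+2) <= 1.
  rewrite ler_pdivrMr // mul1r.
  have : s i.+1 * x <= s i.+1 * 1 by rewrite ler_wpM2l.
  lra.
have h2 : s i * x / (s i * x + s i.+1) <= 2^-1.
  rewrite ler_pdivrMr //.
  have : s i * x <= s i * 1 by rewrite ler_wpM2l.
  lra.
have -> : 2 * k * (2 * s i.+1 * x / (s i.+1 * x + s i.+2) + s i * x / (s i * x + s i.+1) - 1) =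
  k * (2 * (2 * s i.+1 * x / (s i.+1 * x + s i.+2) + s i * x / (s i * x + s i.+1) - 1)) by ring.
rewrite -[leRHS]mulr1 ler_wpM2l //; lra.
Qed.

(** For i > 0 both s(i+1) and s(i+2) are at least lambda. Bounding two of the three factors s(i+2) x
    + s(i+1) below by lambda (x + 1) leaves a multiple of the weight of the branch, and weights
    telescope when summed. *)
Lemma atom2_bound i : (0 < i)%N -> (i < p)%N ->
  ((s i.+2 * x + s i.+1) ^+ 3 * (s i.+1 * x + s i))^-1 <=
  ((s 2%N * (x + 1)) ^+ 2 * x)^-1 * (wA i x - wA i.+1 x).
Proof.
move=> i0 ip; rewrite wA_sub //.
have M0 := br_up_den_gt0 i x ip (ltW x0); have N0 := wA_den_gt0 i x (ltnW ip) x0.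
have [c0 cb ba b1 d] := s_abc i ip.
have lb := s_ge_s2 i i0 (ltnW ip); have l1 := s2_ge1.
have l0 := lt_le_trans ltr01 l1.
have y0 : 0 < x + 1 by rewrite ltr_pwDl.
have L0 : 0 < s 2%N * (x + 1) by rewrite mulr_gt0 // (lt_le_trans ltr01).
have LM : s 2%N * (x + 1) <= s i.+2 * x + s i.+1.
  by rewrite mulrDr mulr1 lerD // ler_wpM2r ?(ltW x0) // (le_trans lb).
have -> : ((s 2%N * (x + 1)) ^+ 2 * x)^-1 *
    (x / ((s i.+2 * x + s i.+1) * (s i.+1 * x + s i))) =
    ((s 2%N * (x + 1)) ^+ 2 * ((s i.+2 * x + s i.+1) * (s i.+1 * x + s i)))^-1.
  by field; rewrite !gt_eqF // (lt_le_trans ltr01).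
rewrite lef_pV2 ?posrE ?mulr_gt0 ?exprn_gt0 //.
rewrite [leRHS](_ : _ = (s i.+2 * x + s i.+1) ^+ 2 * ((s i.+2 * x + s i.+1) * (s i.+1 * x + s i))); last by ring.
rewrite ler_wpM2r ?mulr_ge0 ?(ltW M0) ?(ltW N0) //.
by rewrite lerXn2r // nnegrE ltW.
Qed.

End Weights.

(* The derivatives are required on all of (0, +oo), which every branch maps into
   (0, 1]: this avoids one-sided derivatives at 1. *)
Definition concave_incr (g g1 g2 : R -> R) :=
  [/\ forall y : R, 0 < y -> is_derive y 1 g (g1 y),
      forall y : R, 0 < y -> is_derive y 1 g1 (g2 y) &
      forall y : R, 0 < y -> y <= 1 -> [/\ 0 <= g y, 0 <= g1 y & g2 y <= 0]].

Lemma concave_incr_homo (g g1 g2 : R -> R) (x y : R) :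
  concave_incr g g1 g2 -> 0 < x -> x <= y -> y <= 1 -> g x <= g y.
Proof.
move=> [D1 _ G] x0 xy y1; apply: (derive_ge0_le _ _ g1) => // z /andP[xz zy].
  by apply: D1; apply: lt_le_trans xz.
by have [] := G z (lt_le_trans x0 xz) (le_trans zy y1).
Qed.

Lemma concave_incr_nhomo (g g1 g2 : R -> R) (x y : R) :
  concave_incr g g1 g2 -> 0 < x -> x <= y -> y <= 1 -> g1 y <= g1 x.
Proof.
move=> [_ D2 G] x0 xy y1; rewrite -lerN2.
apply: (derive_ge0_le _ (- g1) (- g2)) => // z /andP[xz zy].
  by apply: is_deriveN; apply: D2; apply: lt_le_trans xz.
by have [_ _ ?] := G z (lt_le_trans x0 xz) (le_trans zy y1); rewrite fctE oppr_ge0.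
Qed.

(** * Invariance of the cone of nonnegative, nondecreasing, concave functions *)

Section Invariance.
Variables (g g1 g2 : R -> R).
Hypothesis G : concave_incr g g1 g2.

Lemma abel_hatT_ge0 (al be : nat -> R) (x : R) : 0 < x -> x <= 1 ->
  (forall i, (i <= p)%N -> be i <= al i) ->
  (forall i, (i < p)%N -> be i <= al i.+1) ->
  al 0%N = be 0%N -> al p = be p ->
  0 <= \sum_(i < p) ((al i - al i.+1) * g (br_up i x) + (be i.+1 - be i) * g (br_down i x)).
Proof.
move=> x0 x1 h1 h2 h3 h4.
apply: (abel_ge0 _ al be (fun i => g (br_up i x)) (fun i => g (br_down i x))) => // i ip.
  apply: (concave_incr_homo _ _ _ _ _ G); first exact: br_up_gt0.
    by apply: br_up_le_down => //; exact: ltW.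
  by apply: br_down_le1 => //; exact: ltW.
apply: (concave_incr_homo _ _ _ _ _ G); first exact: br_down_gt0 (ltnW ip) x0.
  by apply: br_down_le_up => //; exact: ltW.
exact: br_up_le1.
Qed.

(* Each decreasing branch is compensated by the increasing branch to its left, where
   the weight and the slope of g are both larger. *)
Lemma hatT1_ge0 (x : R) : 0 < x -> x <= 1 -> 0 <= hatT1 g g1 x.
Proof.
move=> x0 x1; rewrite /hatT1 big_split /=; apply: addr_ge0.
  apply: (abel_hatT_ge0 (wA1 ^~ x) (wB1 ^~ x)) => //.
  - exact: wB1_le_wA1.
  - exact: wB1_le_wA1S.
  - exact: wA1_0.
  - exact: wA1_p.
apply: sumr_ge0 => -[i ip] _ /=.
rewrite up_atom // down_atom // mulNr subr_ge0 -[leLHS]mulrA -[leRHS]mulrA ler_wpM2l ?(ltW x0) //.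
have u0 := br_up_gt0 i x ip x0; have d0 := br_down_gt0 i x ip x0.
have d1 := br_down_le1 i x ip (ltW x0).
have [_ _ Gp] := G.
have [_ gd0 _] := Gp _ d0 d1.
apply: ler_pM => //.
- have M0 := br_down_den_gt0 i x ip (ltW x0).
  have N0 := wB_den_gt0 i x (ltnW ip) (ltW x0).
  by rewrite invr_ge0 ltW // mulr_gt0 // exprn_gt0.
- exact: inv_up_down_den.
- apply: (concave_incr_nhomo _ _ _ _ _ G) => //.
  by apply: br_up_le_down => //; exact: ltW.
Qed.

(* The terms in g are handled by Abel summation and those in g2 have a sign. In the
   terms in g1, the parabolic one, -4 s(2) / (s(2) x + 1)^4, beats the sum of the
   positive parts of all the others, since g1 is largest at [br_up 0 x]. *)
Lemma hatT2_le0 (x : R) : 0 < x -> x <= 1 -> hatT2 g g1 g2 x <= 0.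
Proof.
move=> x0 x1; rewrite /hatT2 big_split /= big_split /=.
have [_ _ Gp] := G.
have H1 : \sum_(i < p) ((wA2 i x - wA2 i.+1 x) * g (br_up i x) +
    (wB2 i.+1 x - wB2 i x) * g (br_down i x)) <= 0.
  rewrite -oppr_ge0 -sumrN.
  have := abel_hatT_ge0 (fun i => - wA2 i x) (fun i => - wB2 i x) x x0 x1.
  rewrite wA2_0 wA2_p => H.
  rewrite (eq_bigr (fun i : 'I_p => (- wA2 i x - - wA2 i.+1 x) * g (br_up i x) +
    (- wB2 i.+1 x - - wB2 i x) * g (br_down i x))); last by move=> i _; ring.
  by apply: H => // i ip; rewrite lerN2; [exact: wA2_le_wB2|exact: wA2S_le_wB2].
have H3 : \sum_(i < p) ((wA i x - wA i.+1 x) * br_up1 i x ^+ 2 * g2 (br_up i x) +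
    (wB i.+1 x - wB i x) * br_down1 i x ^+ 2 * g2 (br_down i x)) <= 0.
  apply: sumr_le0 => -[i ip] _ /=.
  have [_ _ u2] := Gp _ (br_up_gt0 i x ip x0) (br_up_le1 i x ip x0).
  have [_ _ d2] := Gp _ (br_down_gt0 i x ip x0) (br_down_le1 i x ip (ltW x0)).
  have hu := wA_sub_ge0 i x ip x0; have hd := wB_sub_ge0 i x ip x0.
  rewrite -[leRHS]addr0 lerD // mulr_ge0_le0 // mulr_ge0 // sqr_ge0 //.
suff H2 : \sum_(i < p) (up_atom2 x i * g1 (br_up i x) + down_atom2 x i * g1 (br_down i x)) <= 0.
  by rewrite -[leRHS]addr0 lerD // -[leRHS]addr0 lerD.
set W := g1 (br_up 0 x).
have uW i : (i < p)%N -> g1 (br_down i x) <= g1 (br_up i x) <= W.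
  move=> ip; apply/andP; split.
    apply: (concave_incr_nhomo _ _ _ _ _ G); [exact: br_up_gt0| |].
      by apply: br_up_le_down => //; exact: ltW.
    by apply: br_down_le1 => //; exact: ltW.
  elim: i ip => [|i IH] ip; first exact: lexx.
  apply: le_trans (IH (ltnW ip)).
  apply: (concave_incr_nhomo _ _ _ _ _ G); [exact: br_up_gt0 (ltnW ip) x0| |].
    apply: (le_trans (br_up_le_down i x (ltnW ip) (ltW x0) x1)).
    by apply: br_down_le_up => //; exact: ltW.
  exact: br_up_le1.
have g0u i (ip : (i < p)%N) : 0 <= g1 (br_up i x).
  by have [] := Gp _ (br_up_gt0 i x ip x0) (br_up_le1 i x ip x0).
have g0d i (ip : (i < p)%N) : 0 <= g1 (br_down i x).
  by have [] := Gp _ (br_down_gt0 i x ip x0) (br_down_le1 i x ip (ltW x0)).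
have W0 : 0 <= W by apply: g0u.
pose k := ((s 2%N * (x + 1)) ^+ 2 * x)^-1.
have l1 := s2_ge1; have l0 := lt_le_trans ltr01 l1.
have y0 : 0 < x + 1 by rewrite ltr_pwDl.
have L0 : 0 < s 2%N * (x + 1) by rewrite mulr_gt0 // (lt_le_trans ltr01).
have k0 : 0 < k by rewrite invr_gt0 mulr_gt0 // exprn_gt0.
case E : p p_gt0 => [//|n] _; rewrite big_ord_recl /=.
have T0 : up_atom2 x 0 * g1 (br_up 0 x) + down_atom2 x 0 * g1 (br_down 0 x) <=
    - 4 * s 2%N / (s 2%N * x + 1) ^+ 4 * W.
  rewrite -[leRHS]addr0 lerD //; first by rewrite up_atom2_0.
  by rewrite mulr_le0_ge0 // ?g0d // down_atom2_0.
(* The constant 3 is 2 from [up_atom2_le] plus 1 from [down_atom2_le]. *)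
have Ti (i : 'I_n) : up_atom2 x i.+1 * g1 (br_up i.+1 x) + down_atom2 x i.+1 * g1 (br_down i.+1 x)
    <= 3 * k * W * (wA i.+1 x - wA i.+2 x).
  have ip : (i.+1 < p)%N by rewrite E ltnS.
  have hb := atom2_bound x x0 i.+1 isT ip.
  have hu := up_atom2_le x x0 i.+1 ip.
  have hd := down_atom2_le x x0 x1 i.+1 ip.
  move: hb hu hd; rewrite -/k; set E' := (_ * _)^-1; set w := wA _ _ - _ => hb hu hd.
  have E0 : 0 <= E'.
    have M0 := br_up_den_gt0 i.+1 x ip (ltW x0).
    have N0 := wA_den_gt0 i.+1 x (ltnW ip) x0.
    by rewrite /E' invr_ge0 ltW // mulr_gt0 // exprn_gt0.
  have /andP[duW uWW] := uW _ ip.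
  have a1 : up_atom2 x i.+1 * g1 (br_up i.+1 x) <= 2 * (k * w) * W.
    apply: (@le_trans _ _ (2 * E' * g1 (br_up i.+1 x))).
      by rewrite ler_wpM2r // g0u.
    by apply: ler_pM => //; rewrite ?mulr_ge0 ?g0u // ler_wpM2l.
  have a2 : down_atom2 x i.+1 * g1 (br_down i.+1 x) <= (k * w) * W.
    apply: (@le_trans _ _ (E' * g1 (br_down i.+1 x))).
      by rewrite ler_wpM2r // g0d.
    by apply: ler_pM => //; rewrite ?g0d // (le_trans duW).
  lra.
apply: (@le_trans _ _ (- 4 * s 2%N / (s 2%N * x + 1) ^+ 4 * W +
    \sum_(i < n) 3 * k * W * (wA i.+1 x - wA i.+2 x))).
  apply: lerD => //; apply: ler_sum => i _; exact: Ti.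
rewrite -mulr_sumr (sum_telescope _ (fun i => wA i.+1 x)).
have M0 : 0 < s 2%N * x + 1 by rewrite addr_gt0 // mulr_gt0 // (lt_le_trans ltr01).
have -> : wA n.+1 x = x / (x + 1).
  have sp : 1 <= s p by rewrite E; apply: s_ge1; rewrite E.
  have sp0 : s p != 0 by rewrite gt_eqF // (lt_le_trans ltr01).
  have h1 : x + 1 != 0 by rewrite gt_eqF.
  have h2 : s p * x + s p != 0 by rewrite -{2}[s p]mulr1 -mulrDr mulf_neq0.
  by rewrite -E /wA s_end; field; rewrite ?sp0 ?h1 ?h2.
have -> : wA 1 x = s 2%N * x / (s 2%N * x + 1) by rewrite /wA s1 addr0.
(* All that remains is that the telescoped sum, wA 1 - wA p, is dominated by the parabolic term.
   This reduces to lambda x + 1 <= lambda (x + 1) and 3 (lambda - 1) <= 4; the latter uses lambda <=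
   2. *)
suff : 3 * k * (s 2%N * x / (s 2%N * x + 1) - x / (x + 1)) <= 4 * s 2%N / (s 2%N * x + 1) ^+ 4.
  by move=> H; have := ler_wpM2r W0 H; lra.
have -> : 3 * k * (s 2%N * x / (s 2%N * x + 1) - x / (x + 1)) =
  (3 * (s 2%N - 1)) / ((s 2%N) ^+ 2 * (x + 1) ^+ 3 * (s 2%N * x + 1)).
  by rewrite /k; field; rewrite !gt_eqF.
have P4 : 0 < (s 2%N * x + 1) ^+ 4 by rewrite exprn_gt0.
have P6 : 0 < s 2%N ^+ 2 * (x + 1) ^+ 3 * (s 2%N * x + 1).
  by rewrite !mulr_gt0 // exprn_gt0.
rewrite ler_pdiv2 //.
have M3 : (s 2%N * x + 1) ^+ 3 <= (s 2%N * (x + 1)) ^+ 3.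
  by rewrite lerXn2r // ?nnegrE ?(ltW M0) ?(ltW L0) // mulrDr mulr1 lerD2l.
have h4 : 3 * (s 2%N - 1) <= 4 by have := s2_le2; lra.
have h3 : 0 <= 3 * (s 2%N - 1) by lra.
have H := ler_pM h3 (exprn_ge0 3 (ltW M0)) h4 M3.
have := ler_wpM2r (ltW M0) H.
rewrite [leLHS](_ : _ = 3 * (s 2%N - 1) * (s 2%N * x + 1) ^+ 4); last by ring.
by rewrite [leRHS](_ : _ = 4 * s 2%N * (s 2%N ^+ 2 * (x + 1) ^+ 3 * (s 2%N * x + 1))) //; ring.
Qed.

Lemma concave_incr_hatT : concave_incr (hatT g) (hatT1 g g1) (hatT2 g g1 g2).
Proof.
have [D1 D2 Gp] := G.
split=> [y y0|y y0|y y0 y1]; [exact: is_derive_hatT|exact: is_derive_hatT1|].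
split; [|exact: hatT1_ge0|exact: hatT2_le0].
apply: sumr_ge0 => -[i ip] _ /=; rewrite /hatT_term.
have [u _ _] := Gp _ (br_up_gt0 i y ip y0) (br_up_le1 i y ip y0).
have [d _ _] := Gp _ (br_down_gt0 i y ip y0) (br_down_le1 i y ip (ltW y0)).
by rewrite addr_ge0 // mulr_ge0 // ?wA_sub_ge0 ?wB_sub_ge0.
Qed.

End Invariance.

(** If U is the distribution function of a measure on [0, 1], this is that of its image under F_q:
    the points sent above x lie strictly between [br_up i x] and [br_down i x] for some i, and their
    mass is removed from the total U 1. *)
Definition push_cdf (U : R -> R) (x : R) :=
  U 1 + \sum_(i < p) (U (br_up i x) - U (br_down i x)).

Lemma br_up_at1 i : (i < p)%N -> br_up i 1 = br_down i 1.
Proof. by move=> ip; rewrite /br_up /br_down !mulr1 addrC [X in _ / X]addrC. Qed.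

Lemma push_cdf_1 (U : R -> R) : push_cdf U 1 = U 1.
Proof.
by rewrite /push_cdf big1 ?addr0 // => -[i ip] _ /=; rewrite br_up_at1 // subrr.
Qed.

(** At x = 0 the intervals between [br_up i] and [br_down i] tile [0, 1], the last one ending at 1
    by [s_end]. *)
Lemma push_cdf_0 (U : R -> R) : U 0 = 0 -> push_cdf U 0 = 0.
Proof.
move=> U0; rewrite /push_cdf.
rewrite (eq_bigr (fun i : 'I_p => U (s i / s i.+1) - U (s i.+1 / s i.+2))); last first.
  by move=> i _; rewrite /br_up /br_down !mulr0 !add0r.
rewrite (sum_telescope _ (fun i => U (s i / s i.+1))) s0 mul0r U0 s_end.
have sp : 1 <= s p.
  by case: p p_gt0 s_ge1 => // n _ h; apply: h.
by rewrite divff ?add0r ?subrr // gt_eqF // (lt_le_trans ltr01).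
Qed.

(** Here g is the density relative to dy/y. At the neutral fixed point 0 only the value of U is
    prescribed, neither a derivative nor continuity. *)
Definition cdf_of (U g : R -> R) :=
  U 0 = 0 /\ forall y : R, 0 < y -> is_derive y 1 U (g y / y).

Lemma br_up_atom i (x : R) : (i < p)%N -> 0 < x ->
  br_up1 i x / br_up i x = (wA i x - wA i.+1 x) / x.
Proof.
move=> ip x0; rewrite wA_sub // /br_up1 /br_up.
have M0 := br_up_den_gt0 i x ip (ltW x0); have N0 := wA_den_gt0 i x (ltnW ip) x0.
by field; rewrite !gt_eqF.
Qed.

Lemma br_down_atom i (x : R) : (i < p)%N -> 0 < x ->
  br_down1 i x / br_down i x = - ((wB i.+1 x - wB i x) / x).
Proof.
move=> ip x0; rewrite wB_sub // /br_down1 /br_down.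
have M'0 := br_down_den_gt0 i x ip (ltW x0).
have N'0 := wB_den_gt0 i x (ltnW ip) (ltW x0).
by field; rewrite !gt_eqF.
Qed.

(** This is the invariance of dx/x: the two sums telescope from wA 0 = 1 and wB 0 = 0 to values at p
    that coincide by [s_end]. *)
Lemma sum_weights (x : R) : 0 < x ->
  \sum_(i < p) (wA i x - wA i.+1 x + (wB i.+1 x - wB i x)) = 1.
Proof.
move=> x0; rewrite big_split /= (sum_telescope _ (wA ^~ x)).
have -> : \sum_(i < p) (wB i.+1 x - wB i x) = wB p x - wB 0 x.
  rewrite -[RHS]opprB -(sum_telescope _ (wB ^~ x)) -sumrN.
  by apply: eq_bigr => i _; rewrite opprB.
have -> : wA p x = wB p x by rewrite /wA /wB s_end.
rewrite addrA subrK /wA /wB s0 s1 !mul0r !addr0 mul0r subr0 mul1r divff //.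
by rewrite gt_eqF.
Qed.

(* [push_cdf U] without the increment of [U] through the parabolic branch [br_up 0]. *)
Definition rest_cdf_term (U : R -> R) (i : nat) (x : R) :=
  (if i == 0%N then 0 else U (br_up i x)) - U (br_down i x).

Definition rest_cdf (U : R -> R) (x : R) := U 1 + \sum_(i < p) rest_cdf_term U i x.

Lemma rest_cdfE (U : R -> R) (x : R) : push_cdf U x - U (br_up 0 x) = rest_cdf U x.
Proof.
rewrite /push_cdf /rest_cdf; case: p p_gt0 => // n _.
rewrite !big_ord_recl /=.
rewrite (eq_bigr (fun i : 'I_n => rest_cdf_term U i.+1 x)) //.
have -> : rest_cdf_term U 0 x = - U (br_down 0 x) by rewrite /rest_cdf_term sub0r.
by rewrite (eq_bigr (fun i : 'I_n => rest_cdf_term U i.+1 x)) //; ring.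
Qed.

Definition rest_density_term (g : R -> R) (i : nat) (x : R) :=
  (if i == 0%N then 0 else g (br_up i x) / br_up i x * br_up1 i x) -
  g (br_down i x) / br_down i x * br_down1 i x.

(** The point 0 is allowed: [br_up 0] is the only branch fixing 0, and the remaining branches send 0
    to positive points, where U is differentiable. *)
Lemma is_derive_rest_cdf (U g : R -> R) (x : R) : cdf_of U g -> 0 <= x ->
  is_derive x 1 (rest_cdf U) (\sum_(i < p) rest_density_term g i x).
Proof.
move=> [_ DU] x0.
have D : is_derive x 1 (fun y => \sum_(i < p) rest_cdf_term U i y)
    (\sum_(i < p) rest_density_term g i x).
  apply: (@is_derive_bigsum R p (rest_cdf_term U) x (rest_density_term g ^~ x)) => i ip.
  have [c0 cb ba b1 d] := s_abc i ip.
  have d0 : 0 < br_down i x.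
    by rewrite divr_gt0 ?br_down_den_gt0 // affine_gt0r.
  have Dd := is_derive1_comp (DU _ d0) (is_derive_br_down i x ip x0).
  have Du : is_derive x 1 (fun y => if i == 0%N then 0 else U (br_up i y))
     (if i == 0%N then 0 else g (br_up i x) / br_up i x * br_up1 i x).
    case: eqP => [_|/eqP i0]; first exact: is_derive_cst.
    have u0 : 0 < br_up i x.
      have si : 1 <= s i.
        by move: i0 ip {c0 cb ba b1 d d0 Dd}; case: i => // j _ jp; apply: s_ge1; lia.
      rewrite divr_gt0 ?br_up_den_gt0 // affine_gt0r //.
      exact: le_trans cb.
    exact: is_derive1_comp (DU _ u0) (is_derive_br_up i x ip x0).
  exact: (is_derive_eq (is_deriveB Du Dd)).
apply: (is_derive_eq (is_deriveD (is_derive_cst (U 1) x 1) D)).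
by rewrite add0r.
Qed.

Lemma rest_density_sum (g : R -> R) (x : R) : 0 < x ->
  \sum_(i < p) rest_density_term g i x =
  (hatT g x - (wA 0 x - wA 1 x) * g (br_up 0 x)) / x.
Proof.
move=> x0.
have -> : \sum_(i < p) rest_density_term g i x = \sum_(i < p)
   (hatT_term g i x - (if i == 0%N :> nat then (wA 0 x - wA 1 x) * g (br_up 0 x) else 0)) / x.
  apply: eq_bigr => -[i ip] _; rewrite /rest_density_term /hatT_term /=.
  rewrite -[_ * br_down1 i x]mulrA [_^-1 * br_down1 i x]mulrC br_down_atom //.
  case: eqP => [->|_]; first by ring.
  rewrite -[_ * br_up1 i x]mulrA [_^-1 * br_up1 i x]mulrC br_up_atom //; ring.
rewrite -mulr_suml sumrB; congr ((_ - _) / _).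
case: p p_gt0 => // n _.
by rewrite big_ord_recl /= big1 ?addr0.
Qed.

Lemma cdf_of_push_cdf (U g : R -> R) : cdf_of U g -> cdf_of (push_cdf U) (hatT g).
Proof.
move=> UG; have [U0 DU] := UG; split; first exact: push_cdf_0.
move=> x x0.
have -> : push_cdf U = (fun x => rest_cdf U x + U (br_up 0 x)).
  by apply/funext => y; rewrite -rest_cdfE subrK.
have u0 := br_up_gt0 0 x p_gt0 x0.
have D := is_deriveD (is_derive_rest_cdf U g x UG (ltW x0))
  (is_derive1_comp (DU _ u0) (is_derive_br_up 0 x p_gt0 (ltW x0))).
apply: (is_derive_eq D); rewrite rest_density_sum //.
rewrite -[_ * br_up1 0 x]mulrA [_^-1 * br_up1 0 x]mulrC br_up_atom //.
by ring.
Qed.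

Lemma br_up_0E (x : R) : br_up 0 x = x / (s 2%N * x + 1).
Proof. by rewrite /br_up s0 s1 mul1r addr0. Qed.

Lemma parabolic_weightE (x : R) : 0 < x -> wA 0 x - wA 1 x = (s 2%N * x + 1)^-1.
Proof.
move=> x0; have := br_up_den_gt0 0 x p_gt0 (ltW x0).
rewrite wA_sub // s1 s0 mul1r addr0 => M0.
by field; rewrite !gt_eqF.
Qed.

Definition is_concave_incr (g : R -> R) := exists g1 g2, concave_incr g g1 g2.

Lemma is_concave_incr_homo (g : R -> R) (x y : R) :
  is_concave_incr g -> 0 < x -> x <= y -> y <= 1 -> g x <= g y.
Proof. by move=> [g1 [g2 G]]; exact: concave_incr_homo G. Qed.

Lemma is_concave_incr_ge0 (g : R -> R) (x : R) : is_concave_incr g -> 0 < x -> x <= 1 -> 0 <= g x.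
Proof. by move=> [g1 [g2 [_ _ G]]] x0 x1; have [] := G x x0 x1. Qed.

Lemma is_concave_incr_hatT (g : R -> R) : is_concave_incr g -> is_concave_incr (hatT g).
Proof.
move=> [g1 [g2 G]]; exists (hatT1 g g1), (hatT2 g g1 g2).
exact: concave_incr_hatT.
Qed.

(** Except at [br_up 0 x], g is replaced by its largest value g 1, and the weights sum to 1. Applied
    at 1 this gives [c_drop]; applied at [orbit1 m] it drives the induction in [gn_orbit1_cvg]. *)
Lemma hatT_le (g : R -> R) (x : R) : is_concave_incr g -> 0 < x -> x <= 1 ->
  hatT g x <= (s 2%N * x + 1)^-1 * g (br_up 0 x) + (1 - (s 2%N * x + 1)^-1) * g 1.
Proof.
move=> G x0 x1.
suff : hatT g x - g 1 <= (s 2%N * x + 1)^-1 * (g (br_up 0 x) - g 1) by lra.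
have -> : hatT g x - g 1 = hatT g x -
    (\sum_(i < p) (wA i x - wA i.+1 x + (wB i.+1 x - wB i x))) * g 1.
  by rewrite sum_weights // mul1r.
rewrite mulr_suml -sumrB.
have up i (ip : (i < p)%N) : (wA i x - wA i.+1 x) * (g (br_up i x) - g 1) <= 0.
  rewrite mulr_ge0_le0 ?wA_sub_ge0 // subr_le0.
  by apply: is_concave_incr_homo => //; [exact: br_up_gt0|exact: br_up_le1].
have down i (ip : (i < p)%N) : (wB i.+1 x - wB i x) * (g (br_down i x) - g 1) <= 0.
  rewrite mulr_ge0_le0 ?wB_sub_ge0 // subr_le0.
  by apply: is_concave_incr_homo => //; [exact: br_down_gt0|exact: br_down_le1 (ltW x0)].
rewrite (eq_bigr (fun i : 'I_p => (wA i x - wA i.+1 x) * (g (br_up i x) - g 1) +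
    (wB i.+1 x - wB i x) * (g (br_down i x) - g 1))); last first.
  by move=> i _; rewrite /hatT_term; ring.
rewrite -parabolic_weightE //; move: up down p_gt0; case: p => // n up down _.
rewrite big_ord_recl /= -addrA -[leRHS]addr0 lerD2l.
rewrite -[leRHS]addr0 lerD ?down //.
apply: sumr_le0 => -[i ip] _ /=; rewrite -[leRHS]addr0 lerD //; [exact: up|exact: down].
Qed.

(* The orbit of 1 under the parabolic branch. *)
Definition orbit1 (j : nat) : R := (1 + j%:R * s 2%N)^-1.

Lemma orbit1_den_gt0 j : 0 < 1 + j%:R * s 2%N.
Proof. by rewrite ltr_pwDl // mulr_ge0 // (le_trans ler01) // s2_ge1. Qed.

Lemma orbit1_gt0 j : 0 < orbit1 j. Proof. by rewrite invr_gt0 orbit1_den_gt0. Qed.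

Lemma orbit1_le1 j : orbit1 j <= 1.
Proof.
rewrite invf_le1 ?orbit1_den_gt0 // lerDl mulr_ge0 // (le_trans ler01) //.
exact: s2_ge1.
Qed.

Lemma orbit1_0 : orbit1 0 = 1. Proof. by rewrite /orbit1 mul0r addr0 invr1. Qed.

Lemma br_up_orbit1 j : br_up 0 (orbit1 j) = orbit1 j.+1.
Proof.
rewrite br_up_0E /orbit1 -natr1.
have -> : 1 + (j%:R + 1) * s 2%N = (1 + j%:R * s 2%N) + s 2%N by ring.
have := orbit1_den_gt0 j; set D := 1 + _ => D0.
have D1 : D + s 2%N != 0 by rewrite gt_eqF // addr_gt0 // (lt_le_trans ltr01) // s2_ge1.
by field; rewrite D1 gt_eqF.
Qed.

(** Since orbit1 j / orbit1 (j+1) = 1 + lambda orbit1 j, this is the dx/x-measure of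
    [orbit1 (j+1), orbit1 j]. It is also the dx/x-measure of the points of [orbit1 1, 1] that land
    in [0, orbit1 j], that is, the tail of a return time. *)
Definition tau (j : nat) : R := ln (1 + s 2%N * orbit1 j).

(** The density of [rest_cdf U] at y is 1/y times a sum of weights of total 1 - 1/(1 + lambda y),
    against values of g at preimages in [orbit1 1, 1]. Hence it lies between g (orbit1 1) and g 1
    times lambda / (1 + lambda y), the derivative of the logarithm. *)
Lemma rest_cdf_bounds (U g : R -> R) (x : R) : cdf_of U g -> is_concave_incr g -> 0 < x -> x <= 1 ->
  g (orbit1 1) * ln (1 + s 2%N * x) <= rest_cdf U x <= g 1 * ln (1 + s 2%N * x).
Proof.
move=> UG G x0 x1.
have l1 := s2_ge1; have l0 := lt_le_trans ltr01 l1.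
have restU0 : rest_cdf U 0 = 0.
  by rewrite -rest_cdfE br_up_0E mul0r push_cdf_0 ?(proj1 UG) // subrr.
have dpos (y : R) : 0 <= y -> 0 < 1 + s 2%N * y by move=> y0; rewrite ltr_pwDl // mulr_ge0 // ltW.
pose ld (y : R) := s 2%N / (1 + s 2%N * y).
have Dk (k y : R) : 0 <= y ->
    is_derive y 1 (fun y : R => k * ln (1 + s 2%N * y)) (k * ld y).
  move=> y0; have D := is_derive_ln_affine R (s 2%N) y (dpos y y0).
  apply: (is_derive_eq (is_deriveM (is_derive_cst k y 1) D)).
  by rewrite /GRing.scale /= mulr0 addr0.
have bnd (y : R) : 0 < y -> y <= 1 ->
    g (orbit1 1) * ld y <= \sum_(i < p) rest_density_term g i y <= g 1 * ld y.
  move=> y0 y1; rewrite rest_density_sum //.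
  have ldE : ld y = (1 - (wA 0 y - wA 1 y)) / y.
    have := dpos y (ltW y0); rewrite addrC => h.
    by rewrite parabolic_weightE // /ld addrC; field; rewrite !gt_eqF.
  rewrite ldE !mulrA.
  have up i (ip : (i < p)%N) : (0 < i)%N -> g (orbit1 1) <= g (br_up i y) <= g 1.
    case: i ip => // i ip _.
    (* The leftmost preimage other than [br_up 0 y] is br_down 0 y = 1/(y + lambda), and y <= 1. *)
    have d1 : orbit1 1 <= br_down 0 y.
      rewrite /orbit1 /br_down s0 s1 mul0r add0r !mul1r lef_pV2 ?posrE ?addr_gt0 //.
      by rewrite lerD2r.
    have du : br_down 0 y <= br_up i.+1 y.
      elim: i ip => [|i IH] ip; first by apply: br_down_le_up => //; exact: ltW.
      apply: (le_trans (IH (ltnW ip))).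
      apply: (le_trans (br_up_le_down i.+1 y (ltnW ip) (ltW y0) y1)).
      by apply: br_down_le_up => //; exact: ltW.
    rewrite !is_concave_incr_homo ?orbit1_gt0 ?br_up_gt0 ?br_up_le1 //.
    exact: le_trans du.
  have down i (ip : (i < p)%N) : g (orbit1 1) <= g (br_down i y) <= g 1.
    have d1 : orbit1 1 <= br_down i y.
      elim: i ip => [|i IH] ip.
        rewrite /orbit1 /br_down s0 s1 mul0r add0r !mul1r lef_pV2 ?posrE ?addr_gt0 //.
        by rewrite lerD2r.
      apply: (le_trans (IH (ltnW ip))).
      apply: (le_trans (br_down_le_up i y ip (ltW y0))).
      by apply: br_up_le_down => //; exact: ltW.
    by rewrite !is_concave_incr_homo ?orbit1_gt0 ?br_down_gt0 ?br_down_le1 ?(ltW y0).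
  have sumE : \sum_(i < p) (wA i y - wA i.+1 y + (wB i.+1 y - wB i y)) = 1 by exact: sum_weights.
  (* The density and both its bounds are the same weighted sum over the non-parabolic branches,
     taken at the values of g or at a constant, and can be compared term by term. *)
  pose rest (h : nat -> R) (h' : nat -> R) := \sum_(i < p)
     ((if i == 0%N :> nat then 0 else (wA i y - wA i.+1 y) * h i) + (wB i.+1 y - wB i y) * h' i).
  have E1 : hatT g y - (wA 0 y - wA 1 y) * g (br_up 0 y) =
      rest (fun i => g (br_up i y)) (fun i => g (br_down i y)).
    rewrite /hatT /rest; case: (p) p_gt0 => // n _; rewrite !big_ord_recl /= add0r.
    by rewrite /hatT_term /= ; ring.
  have E2 k : k * (1 - (wA 0 y - wA 1 y)) = rest (fun=> k) (fun=> k).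
    have S : \sum_(i < p) (if i == 0%N :> nat then k * (wA 0 y - wA 1 y) else 0) =
        k * (wA 0 y - wA 1 y).
      by case: (p) p_gt0 => // n _; rewrite big_ord_recl /= big1 ?addr0.
    have kE : k = (\sum_(i < p) (wA i y - wA i.+1 y + (wB i.+1 y - wB i y))) * k.
      by rewrite sumE mul1r.
    rewrite mulrBr mulr1 {1}kE mulr_suml -S -sumrB /rest.
    by apply: eq_bigr => i _; case: eqP => [->|_]; ring.
  have iV : 0 <= y^-1 by rewrite invr_ge0 ltW.
  rewrite E1 !E2; apply/andP; split; rewrite ler_wpM2r //; apply: ler_sum => -[i ip] _ /=.
    apply: lerD; last by rewrite ler_wpM2l ?wB_sub_ge0 //; case/andP: (down i ip).
    case: eqP => // /eqP; rewrite -lt0n => /(up i ip)/andP[? ?]; rewrite ler_wpM2l ?wA_sub_ge0 //.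
  apply: lerD; last by rewrite ler_wpM2l ?wB_sub_ge0 //; case/andP: (down i ip).
  case: eqP => // /eqP; rewrite -lt0n => /(up i ip)/andP[? ?]; rewrite ler_wpM2l ?wA_sub_ge0 //.
have Dr (y : R) : 0 <= y -> is_derive y 1 (rest_cdf U) (\sum_(i < p) rest_density_term g i y).
  by move=> y0; exact: is_derive_rest_cdf.
have wc (f df : R -> R) : (forall y : R, 0 <= y -> is_derive y 1 f (df y)) ->
    {within `[0, x], continuous f}.
  by move=> h; apply: (is_derive_within_continuous _ _ df) => y /andP[y0 _]; apply: h.
apply/andP; split; rewrite -subr_ge0.
  have := @derive_ge0_le_oo R (rest_cdf U \- (fun y => g (orbit1 1) * ln (1 + s 2%N * y)))
    (fun y => \sum_(i < p) rest_density_term g i y - g (orbit1 1) * ld y) 0 x (ltW x0).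
  have D (y : R) (y0 : 0 <= y) := is_deriveB (Dr y y0) (Dk (g (orbit1 1)) y y0).
  rewrite /= restU0 mulr0 addr0 ln1 mulr0 subrr; apply.
  - by apply: wc => y y0; exact: D.
  - by move=> y /andP[y0 _]; apply: D; exact: ltW.
  - move=> y /andP[y0 yx]; rewrite subr_ge0.
    by have /andP[] := bnd y y0 (le_trans (ltW yx) x1).
have := @derive_ge0_le_oo R ((fun y => g 1 * ln (1 + s 2%N * y)) \- rest_cdf U)
    (fun y => g 1 * ld y - \sum_(i < p) rest_density_term g i y) 0 x (ltW x0).
have D (y : R) (y0 : 0 <= y) := is_deriveB (Dk (g 1) y y0) (Dr y y0).
rewrite /= restU0 mulr0 addr0 ln1 mulr0 subrr; apply.
- by apply: wc => y y0; exact: D.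
- by move=> y /andP[y0 _]; apply: D; exact: ltW.
- move=> y /andP[y0 yx]; rewrite subr_ge0.
  by have /andP[] := bnd y y0 (le_trans (ltW yx) x1).
Qed.

Lemma tauE j : tau j = ln (1 + j.+1%:R * s 2%N) - ln (1 + j%:R * s 2%N).
Proof.
have h := orbit1_den_gt0 j; have h' := orbit1_den_gt0 j.+1.
rewrite -ln_div ?posrE // /tau; congr ln.
by rewrite /orbit1 -natr1; field; rewrite gt_eqF.
Qed.

Lemma tau_sum N : \sum_(0 <= k < N) tau k = ln (1 + N%:R * s 2%N).
Proof.
rewrite (eq_bigr (fun k => ln (1 + k.+1%:R * s 2%N) - ln (1 + k%:R * s 2%N))); last first.
  by move=> k _; rewrite tauE.
by rewrite telescope_sumr // mul0r addr0 ln1 subr0.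
Qed.

Lemma orbit1_noninc m n : (m <= n)%N -> orbit1 n <= orbit1 m.
Proof.
move=> mn; rewrite /orbit1 lef_pV2 ?posrE ?orbit1_den_gt0 // lerD2l ler_wpM2r ?ler_nat //.
exact: le_trans ler01 s2_ge1.
Qed.

Lemma s2_gt0 : 0 < s 2%N. Proof. exact: lt_le_trans ltr01 s2_ge1. Qed.

Lemma tau_arg_gt0 j : 0 < 1 + s 2%N * orbit1 j.
Proof. by rewrite ltr_pwDl // mulr_ge0 // ltW // ?orbit1_gt0 // s2_gt0. Qed.

Lemma tau_ge0 j : 0 <= tau j.
Proof. by rewrite ln_ge0 // lerDl mulr_ge0 // ltW // ?orbit1_gt0 // s2_gt0. Qed.

Lemma tau_noninc m n : (m <= n)%N -> tau n <= tau m.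
Proof.
move=> mn; rewrite ler_ln ?posrE ?tau_arg_gt0 // lerD2l ler_wpM2l ?orbit1_noninc //.
exact: ltW s2_gt0.
Qed.

Lemma tau_le n : tau n.+1 <= n.+1%:R^-1.
Proof.
apply: (@le_trans _ _ (s 2%N * orbit1 n.+1)).
  apply: le_ln1Dx; rewrite (@lt_le_trans _ _ 0) ?ltrN10 // mulr_ge0 // ltW // ?orbit1_gt0 //.
  exact: s2_gt0.
rewrite /orbit1 -[leRHS]mul1r ler_pdiv2 ?orbit1_den_gt0 ?ltr0n //.
by rewrite mul1r mulrC lerDr.
Qed.

(** * Renewal asymptotics of the transported densities *)

Section Asymptotics.
Variables (U0 g0 : R -> R).
Hypothesis U0g0 : cdf_of U0 g0.
Hypothesis g0_good : is_concave_incr g0.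
Hypothesis U0_orbit1_cvg0 : U0 (orbit1 n) @[n --> \oo] --> (0 : R).

Let Un n := iter n push_cdf U0.
Let gn n := iter n hatT g0.
Let c n := gn n 1.
Let w n : R := ln (1 + n%:R * s 2%N).

Lemma gn_concave_incr n : is_concave_incr (gn n).
Proof. by elim: n => // n IH; exact: is_concave_incr_hatT. Qed.

Lemma Un_cdf n : cdf_of (Un n) (gn n).
Proof. by elim: n => // n IH; exact: cdf_of_push_cdf. Qed.

Lemma Un1 n : Un n 1 = U0 1.
Proof. by elim: n => // n IH; rewrite /Un iterS push_cdf_1. Qed.

Lemma gn_le_c n x : 0 < x -> x <= 1 -> 0 <= gn n x <= c n.
Proof.
move=> x0 x1; rewrite (is_concave_incr_ge0 _ _ (gn_concave_incr n)) //=.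
exact: is_concave_incr_homo (gn_concave_incr n) _ _ _.
Qed.

Lemma c_drop n :
  (s 2%N * 1 + 1)^-1 * (c n - gn n (orbit1 1)) <= c n - c n.+1.
Proof.
have := hatT_le (gn n) 1 (gn_concave_incr n) ltr01 (lexx 1).
have -> : br_up 0 1 = orbit1 1 by rewrite -br_up_orbit1 orbit1_0.
rewrite /c /gn iterS; set k := _^-1; lra.
Qed.

(** As [br_up 0] sends orbit1 j to orbit1 (j+1), the difference is the mass that enters
    [0, orbit1 j] at step n + 1 through the other branches. *)
Lemma Un_increment n j : gn n (orbit1 1) * tau j <= Un n.+1 (orbit1 j) - Un n (orbit1 j.+1) <= c n * tau j.
Proof.
have := rest_cdf_bounds (Un n) (gn n) (orbit1 j) (Un_cdf n) (gn_concave_incr n) (orbit1_gt0 j) (orbit1_le1 j).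
by rewrite -rest_cdfE br_up_orbit1.
Qed.

(** Term k is the mass that lies in [orbit1 1, 1] at time k and lands in [0, orbit1 (N-1-k)], so
    that it stays below orbit1 1 at the times k + 1, ..., N - 1. The mass [U0 (orbit1 N)] has not
    reached orbit1 1 before time N. *)
Lemma Un_telescope N : U0 1 - U0 (orbit1 N) =
  \sum_(0 <= k < N) (Un k.+1 (orbit1 (N.-1 - k)) - Un k (orbit1 (N.-1 - k).+1)).
Proof.
rewrite (eq_big_nat _ _ (F2 := fun k => Un k.+1 (orbit1 (N - k.+1)) - Un k (orbit1 (N - k)))).
  by rewrite (telescope_sumr (fun k => Un k (orbit1 (N - k)))) // subnn subn0 orbit1_0 Un1.
move=> k kN; have -> : (N.-1 - k)%N = (N - k.+1)%N by lia.
by have -> : (N - k.+1).+1 = (N - k)%N by lia.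
Qed.

Lemma c_noninc1 n : c n.+1 <= c n.
Proof.
have := c_drop n; have /andP[_] := gn_le_c n (orbit1 1) (orbit1_gt0 1) (orbit1_le1 1).
have k0 : 0 <= (s 2%N * 1 + 1)^-1.
  by rewrite invr_ge0 mulr1 addr_ge0 // ltW // s2_gt0.
by rewrite -subr_ge0 => h; have := mulr_ge0 k0 h; lra.
Qed.

Lemma c_noninc m n : (m <= n)%N -> c n <= c m.
Proof.
move=> /subnK <-; elim: (n - m)%N => [|k IH]; first by rewrite add0n.
by rewrite addSn (le_trans (c_noninc1 _)).
Qed.

Lemma c_ge0 n : 0 <= c n.
Proof. by have /andP[] := gn_le_c n 1 ltr01 (lexx 1). Qed.

Lemma tau_sum_dvg : (\sum_(0 <= k < n) tau k) @[n --> \oo] --> +oo.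
Proof. by under eq_fun do rewrite tau_sum; exact: ln_dvg s2_gt0. Qed.

Lemma pi0_gt0 : 0 < (s 2%N * 1 + 1)^-1.
Proof. by rewrite invr_gt0 mulr1 addr_gt0 // s2_gt0. Qed.

Lemma gn_orbit1_le n : gn n (orbit1 1) <= c n.
Proof. by have /andP[] := gn_le_c n (orbit1 1) (orbit1_gt0 1) (orbit1_le1 1). Qed.

Lemma gn_renewal_lower N :
  \sum_(0 <= k < N) gn k (orbit1 1) * tau (N.-1 - k) <= U0 1 - U0 (orbit1 N).
Proof.
rewrite Un_telescope; apply: ler_sum => k _.
by have /andP[] := Un_increment k (N.-1 - k).
Qed.

Lemma gn_renewal_upper N :
  U0 1 - U0 (orbit1 N) <= \sum_(0 <= k < N) c k * tau (N.-1 - k).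
Proof.
rewrite Un_telescope; apply: ler_sum => k _.
by have /andP[] := Un_increment k (N.-1 - k).
Qed.

Lemma c_to0 : c @ \oo --> (0 : R).
Proof.
exact: (renewal_cvg0 _ _ _ _ _ _ _ c_ge0 c_noninc gn_orbit1_le pi0_gt0 c_drop tau_ge0
  tau_noninc tau_sum_dvg U0_orbit1_cvg0 gn_renewal_lower).
Qed.

Lemma c_w_cvg : c n * w n @[n --> \oo] --> U0 1.
Proof.
rewrite /w; under eq_fun do rewrite -tau_sum.
exact: (renewal_limit _ _ _ _ _ _ _ c_ge0 c_noninc gn_orbit1_le pi0_gt0 c_drop tau_ge0
  tau_noninc tau_le tau_sum_dvg U0_orbit1_cvg0 gn_renewal_lower gn_renewal_upper).
Qed.

Lemma bounded_mul_cvg0 (u b : nat -> R) (B : R) : (forall n, 0 <= u n <= B) ->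
  (forall n, 0 <= b n <= c n) -> b n * u n @[n --> \oo] --> (0 : R).
Proof.
move=> uB bc.
have H : c n * B @[n --> \oo] --> (0 : R).
  by rewrite -(mul0r B); apply: cvgMl; exact: c_to0.
apply: (squeeze_cvgr _ (cvg_cst 0) H); apply: nearW => n.
have /andP[u0 u1] := uB n; have /andP[b0 b1] := bc n.
by rewrite mulr_ge0 //= ler_pM.
Qed.

(** A weighted average of g_n(orbit1 (m+1)) and c_n bounds g_{n+1}(orbit1 m) from above. If the
    latter and c_n have the same limit after scaling, the former cannot stay below it. *)
Lemma gn_orbit1_cvg m : gn n (orbit1 m) * w n @[n --> \oo] --> U0 1.
Proof.
elim: m => [|m IH]; first by rewrite orbit1_0; exact: c_w_cvg.
have le_c n x (x0 : 0 < x) (x1 : x <= 1) := gn_le_c n x x0 x1.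
pose k := (s 2%N * orbit1 m + 1)^-1.
have k0 : 0 < k by rewrite invr_gt0 addrC tau_arg_gt0.
have w0 n : 0 <= w n.
  by rewrite ln_ge0 // lerDl mulr_ge0 // ltW // s2_gt0.
(* [hatT_le] at [orbit1 m] solved for gn n (orbit1 m.+1) and multiplied by w n, with w n written as
   w n.+1 - tau n. *)
pose lo n := ((gn n.+1 (orbit1 m) * w n.+1 - gn n.+1 (orbit1 m) * tau n) - (1 - k) * (c n * w n)) / k.
apply: (@squeeze_cvgr _ _ _ _ lo (fun n => c n * w n)).
- apply: nearW => n; apply/andP; split; last first.
    by rewrite ler_wpM2r //; have /andP[] := le_c n _ (orbit1_gt0 m.+1) (orbit1_le1 m.+1).
  rewrite /lo ler_pdivrMr //.
  have -> : tau n = w n.+1 - w n by exact: tauE.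
  have := hatT_le (gn n) (orbit1 m) (gn_concave_incr n) (orbit1_gt0 m) (orbit1_le1 m).
  rewrite br_up_orbit1 -/k => /(ler_wpM2r (w0 n)).
  rewrite /gn iterS -/(gn n) -/(c n); lra.
- have H1 : gn n.+1 (orbit1 m) * w n.+1 @[n --> \oo] --> U0 1.
    by rewrite (cvg_shiftS (fun n => gn n (orbit1 m) * w n)).
  have H2 : gn n.+1 (orbit1 m) * tau n @[n --> \oo] --> (0 : R).
    apply: (@bounded_mul_cvg0 _ _ (tau 0)) => n; first by rewrite tau_ge0 tau_noninc.
    have /andP[-> h] := le_c n.+1 _ (orbit1_gt0 m) (orbit1_le1 m).
    by rewrite (le_trans h) // c_noninc1.
  have H3 : (1 - k) * (c n * w n) @[n --> \oo] --> (1 - k) * U0 1.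
    by apply: cvgM; [exact: cvg_cst|exact: c_w_cvg].
  have H : lo n @[n --> \oo] --> (U0 1 - 0 - (1 - k) * U0 1) / k.
    by apply: cvgM; [exact: cvgB (cvgB H1 H2) H3|exact: cvg_cst].
  have E : (U0 1 - 0 - (1 - k) * U0 1) / k = U0 1 by field; rewrite gt_eqF.
  by rewrite E in H; exact: H.
- exact: c_w_cvg.
Qed.

Lemma gn_cvg x : 0 < x -> x <= 1 -> gn n x * ln n%:R @[n --> \oo] --> U0 1.
Proof.
move=> x0 x1.
have [m mx] : exists m, orbit1 m <= x.
  exists (Num.truncn x^-1).+1; rewrite /orbit1 -[leRHS]invrK lef_pV2 ?posrE ?orbit1_den_gt0 ?invr_gt0 //.
  apply: (le_trans (ltW (truncnS_gt _))).
  rewrite ler_wpDl // -[leLHS]mulr1 ler_wpM2l //; exact: s2_ge1.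
have w0 n : 0 <= w n.
  by rewrite ln_ge0 // lerDl mulr_ge0 // ltW // s2_gt0.
have H1 : gn n x * w n @[n --> \oo] --> U0 1.
  apply: (squeeze_cvgr _ (gn_orbit1_cvg m) c_w_cvg); apply: nearW => n.
  rewrite !ler_wpM2r //=; first by have /andP[] := gn_le_c n _ x0 x1.
  exact: is_concave_incr_homo (gn_concave_incr n) (orbit1_gt0 m) mx x1.
rewrite -(cvg_shiftS (fun n => gn n x * ln n%:R)).
(* From n + 1 <= 1 + (n + 1) lambda <= (n + 1)(1 + lambda), the two logarithmic scales differ by at
   most log(1 + lambda), while g_n tends to 0. *)
have H2 : gn n.+1 x * (w n.+1 - ln n.+1%:R) @[n --> \oo] --> (0 : R).
  apply: (@bounded_mul_cvg0 _ _ (ln (1 + s 2%N))) => n; last first.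
    have /andP[-> h] := gn_le_c n.+1 _ x0 x1.
    by rewrite (le_trans h) // c_noninc1.
  have n0 : 0 < n.+1%:R :> R by rewrite ltr0n.
  have l0 := s2_gt0; have l1 := s2_ge1.
  have W0 : 0 < 1 + n.+1%:R * s 2%N by exact: orbit1_den_gt0.
  have n1 : 1 <= n.+1%:R :> R by rewrite ler1n.
  have P : 0 < 1 + s 2%N by rewrite addr_gt0.
  apply/andP; split.
    by rewrite subr_ge0 ler_ln ?posrE //; nra.
  rewrite lerBlDr -lnM ?posrE // ler_ln ?posrE //; first by nra.
  by rewrite mulr_gt0.
have H3 : gn n.+1 x * w n.+1 @[n --> \oo] --> U0 1.
  by rewrite (cvg_shiftS (fun n => gn n x * w n)).
have H := cvgB H3 H2; rewrite subr0 in H.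
rewrite (_ : (fun n => _) = (fun n => gn n.+1 x * w n.+1 -
  gn n.+1 x * (w n.+1 - ln n.+1%:R))); first exact: H.
by apply/funext => n; ring.
Qed.

Lemma Un_bounds n a b : 0 < a -> a <= b -> b <= 1 ->
  gn n a * ln (b / a) <= Un n b - Un n a <= gn n b * ln (b / a).
Proof.
move=> a0 ab b1; have b0 := lt_le_trans a0 ab.
have [_ DU] := Un_cdf n.
have Dln (k y : R) : 0 < y -> is_derive y 1 (fun y : R => k * ln y) (k / y).
  move=> y0; apply: (is_derive_eq (is_deriveM (is_derive_cst k y 1) (is_derive1_ln y0))).
  by rewrite /GRing.scale /= mulr0 addr0.
rewrite ln_div ?posrE //; apply/andP; split.
  suff : (Un n \- (fun y => gn n a * ln y)) a <= (Un n \- (fun y => gn n a * ln y)) b.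
    by rewrite /=; lra.
  apply: (derive_ge0_le _ _ (fun y => gn n y / y - gn n a / y)) => // y /andP[ay yb];
    have y0 := lt_le_trans a0 ay.
    exact: (is_deriveB (DU y y0) (Dln _ _ y0)).
  rewrite -mulrBl divr_ge0 ?(ltW y0) // subr_ge0.
  exact: is_concave_incr_homo (gn_concave_incr n) a0 ay (le_trans yb b1).
suff : ((fun y => gn n b * ln y) \- Un n) a <= ((fun y => gn n b * ln y) \- Un n) b.
  by rewrite /=; lra.
apply: (derive_ge0_le _ _ (fun y => gn n b / y - gn n y / y)) => // y /andP[ay yb];
  have y0 := lt_le_trans a0 ay.
  exact: (is_deriveB (Dln _ _ y0) (DU y y0)).
rewrite -mulrBl divr_ge0 ?(ltW y0) // subr_ge0.
exact: is_concave_incr_homo (gn_concave_incr n) y0 yb b1.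
Qed.

Lemma Un_cvg a b : 0 < a -> a <= b -> b <= 1 ->
  ln n%:R * (iter n push_cdf U0 b - iter n push_cdf U0 a) @[n --> \oo] --> ln (b / a) * U0 1.
Proof.
move=> a0 ab b1; have b0 := lt_le_trans a0 ab.
have H x (x0 : 0 < x) (x1 : x <= 1) :
    ln (b / a) * (gn n x * ln n%:R) @[n --> \oo] --> ln (b / a) * U0 1.
  by apply: cvgM; [exact: cvg_cst|exact: gn_cvg].
have H1 := H a a0 (le_trans ab b1); have H2 := H b b0 b1.
apply: (squeeze_cvgr _ H1 H2); apply: nearW => n.
have l0 : 0 <= ln n%:R :> R.
  (* At n = 0 the default value [ln 0 = 0] is used. *)
  by case: n => [|n]; [rewrite ln0|rewrite ln_ge0 // ler1n].
have /andP[h1 h2] := Un_bounds n a b a0 ab b1.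
by rewrite !mulrA ![_ * ln n%:R]mulrC !ler_wpM2l //= mulrC.
Qed.

End Asymptotics.

End Branches.

(** * The branches of the generalized Farey map *)

Section HeckeSine.
Variables (R : realType) (p : nat).
Hypothesis p_gt0 : (0 < p)%N.

Let q := p.*2.+1.
Let theta : R := pi / q%:R.
Definition hsn (i : nat) : R := hs p.*2.+1 i%:R.

Lemma q_gt0 : 0 < q%:R :> R. Proof. by rewrite ltr0n. Qed.

Lemma theta_q : q%:R * theta = pi.
Proof. by rewrite /theta mulrC divfK // gt_eqF // q_gt0. Qed.

Lemma theta_gt0 : 0 < theta. Proof. by rewrite divr_gt0 ?pi_gt0 // q_gt0. Qed.

Lemma hsE (x : R) : hs q x = sin (x * theta) / sin theta.
Proof. by rewrite /hs /theta mulrA. Qed.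

Lemma sin_theta_gt0 : 0 < sin theta.
Proof.
apply: sin_gt0_pi; rewrite theta_gt0 /=.
rewrite -theta_q ltr_pMl ?theta_gt0 // ltr1n /q; lia.
Qed.

Lemma hs_sym (x : R) : hs q (q%:R - x) = hs q x.
Proof.
rewrite !hsE mulrBl theta_q; congr (_ / _).
by rewrite sinB sinpi cospi mul0r sub0r mulN1r opprK.
Qed.

Lemma hsn0 : hsn 0 = 0. Proof. by rewrite /hsn hsE mul0r sin0 mul0r. Qed.

Lemma hsn1 : hsn 1 = 1.
Proof. by rewrite /hsn hsE mul1r divff // gt_eqF // sin_theta_gt0. Qed.

(** At the midpoint angle (i + 1/2) theta the increment has the sign of a cosine. The angle reaches
    pi / 2 exactly at i = p because q = 2 p + 1, so both [hsn_mono] and [hsn_end] can be read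
    off. *)
Lemma hsn_sub i : hsn i.+1 - hsn i =
  2 * cos ((i%:R + 2^-1) * theta) * sin (theta / 2) / sin theta.
Proof.
rewrite /hsn !hsE -mulrBl; congr (_ / _).
set m := (i%:R + 2^-1) * theta.
have -> : i.+1%:R * theta = m + theta / 2 by rewrite -natr1 /m; field.
have -> : i%:R * theta = m - theta / 2 by rewrite /m; field.
by rewrite sinD sinB; ring.
Qed.

Lemma half_theta : (p%:R + 2^-1) * theta = pi / 2.
Proof.
have E : q%:R = p%:R * 2 + 1 :> R by rewrite /q -natr1 -muln2 natrM.
by rewrite -theta_q E; field.
Qed.

Lemma hsn_mono i : (i <= p)%N -> hsn i <= hsn i.+1.
Proof.
move=> ip; rewrite -subr_ge0 hsn_sub.
have t0 := theta_gt0.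
rewrite divr_ge0 ?(ltW sin_theta_gt0) // !mulr_ge0 //.
- apply: cos_ge0_pihalf; apply/andP; split.
    apply: (@le_trans _ _ 0); first by rewrite oppr_le0 divr_ge0 ?pi_ge0.
    by rewrite mulr_ge0 ?(ltW t0) // addr_ge0 // invr_ge0.
  by rewrite -half_theta ler_wpM2r ?(ltW t0) // lerD2r ler_nat.
- apply: sin_ge0_pi; rewrite divr_ge0 ?(ltW t0) //=.
  rewrite -theta_q mulrC ler_wpM2r ?(ltW t0) //.
  by apply: (@le_trans _ _ 1); rewrite ?ler1n // invf_le1 // ler1n.
Qed.

Lemma hsn_end : hsn p.+1 = hsn p.
Proof.
by apply/eqP; rewrite -subr_eq0 hsn_sub half_theta cos_pihalf mulr0 !mul0r.
Qed.

Lemma hsn_det i : (i < p)%N -> hsn i.+1 ^+ 2 - hsn i * hsn i.+2 = 1.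
Proof.
move=> _; rewrite /hsn !hsE.
have s0 : sin theta != 0 by rewrite gt_eqF // sin_theta_gt0.
have -> : i.+2%:R * theta = i.+1%:R * theta + theta by rewrite -(natr1 i.+1); ring.
have -> : i%:R * theta = i.+1%:R * theta - theta by rewrite -natr1; ring.
set b := i.+1%:R * theta.
suff H : sin b ^+ 2 - sin (b - theta) * sin (b + theta) = sin theta ^+ 2.
  rewrite expr_div_n mulrACA -invfM -expr2 -mulrBl H divff // expf_neq0 //.
rewrite sinB [sin (b + theta)]sinD.
have -> : (sin b * cos theta - cos b * sin theta) * (sin b * cos theta + cos b * sin theta)
  = sin b ^+ 2 * cos theta ^+ 2 - cos b ^+ 2 * sin theta ^+ 2 by ring.
rewrite !cos2sin2; ring.
Qed.

Lemma hsn2_le2 : hsn 2 <= 2.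
Proof.
rewrite /hsn hsE ler_pdivrMr ?sin_theta_gt0 //.
have -> : 2 * theta = theta + theta by ring.
have -> : sin (theta + theta) = cos theta * (2 * sin theta) by rewrite sinD; ring.
have h : 0 <= 2 * sin theta by rewrite mulr_ge0 // ltW // sin_theta_gt0.
by rewrite -[leRHS]mul1r ler_wpM2r ?cos_le1.
Qed.

End HeckeSine.

(** [farey] applies the first branch whose interval contains x. A property valid for every eligible
    branch holds for the chosen one, so shared endpoints need no case analysis. *)
Lemma first_match_ind (T A : Type) (K : seq nat) (f g : nat -> T) (P : pred T)
    (F : T -> A) (d : A) (Good : A -> Prop) :
  (forall k, k \in K -> P (f k) -> Good (F (f k))) ->
  (forall k, k \in K -> P (g k) -> Good (F (g k))) ->
  (exists2 k, k \in K & P (f k) || P (g k)) ->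
  Good (match [seq b <- flatten [seq [:: f k; g k] | k <- K] | P b] with
        | b :: _ => F b | [::] => d end).
Proof.
elim: K => [|k K IH] Hf Hg [j jK jP]; first by rewrite in_nil in jK.
rewrite /=; case: ifP => [Pf|nPf]; first by apply: Hf; rewrite ?mem_head.
case: ifP => [Pg|nPg]; first by apply: Hg; rewrite ?mem_head.
apply: IH => [i iK|i iK|].
- by apply: Hf; rewrite in_cons iK orbT.
- by apply: Hg; rewrite in_cons iK orbT.
- exists j => //; move: jK; rewrite in_cons => /orP[/eqP jk|//].
  by rewrite jk nPf nPg in jP.
Qed.

Section FareySpec.
Variables (R : realType) (p : nat).
Hypothesis p_gt0 : (0 < p)%N.
Let q := p.*2.+1.
Let s : nat -> R := @hsn R p.

Let up := br_up R s.
Let down := br_down R s.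

Lemma hs_abc i : (i < p)%N ->
  [/\ 0 <= s i, s i <= s i.+1, s i.+1 <= s i.+2, 1 <= s i.+1 &
      s i.+1 ^+ 2 - s i * s i.+2 = 1].
Proof.
exact: (s_abc R p s (hsn0 R p) (hsn1 R p p_gt0) (hsn_mono R p p_gt0) (hsn_det R p p_gt0)).
Qed.

Lemma gkE i : (i < p)%N ->
  gk R q (p.*2 - i) = mkM2 (s i.+1) (- s i) (- s i.+2) (s i.+1).
Proof.
move=> ip.
have E : (p.*2 - i)%:R = q%:R - i.+1%:R :> R by rewrite -natrB; [congr (_%:R); rewrite /q; lia|rewrite /q; lia].
rewrite /gk; congr mkM2.
- by rewrite E hs_sym.
- congr (- _); rewrite E.
  have -> : q%:R - i.+1%:R + 1 = q%:R - i%:R :> R by rewrite -natr1; ring.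
  exact: hs_sym.
- congr (- _); rewrite E.
  have -> : q%:R - i.+1%:R - 1 = q%:R - i.+2%:R :> R by rewrite -!natr1; ring.
  exact: hs_sym.
- by rewrite E hs_sym.
Qed.

Lemma act_up i x : (i < p)%N -> act (Defs.pinv (gk R q (p.*2 - i))) x = up i x.
Proof. by move=> ip; rewrite gkE // /act /= !opprK. Qed.

Lemma act_down i x : (i < p)%N -> act (Defs.pinv (mmul (Qm R) (gk R q (p.*2 - i)))) x = down i x.
Proof.
move=> ip; rewrite gkE // /act /= !mul0r !mul1r !add0r !addr0.
(* Q g_k has determinant -1, so its adjugate is minus its inverse; the signs cancel in the
   quotient. *)
rewrite -[_ / _]mulrNN -invrN /down /br_down; congr (_ / _); ring.
Qed.

Lemma up_inv i x : (i < p)%N -> up i 0 <= x -> x <= up i 1 ->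
  let z := act (gk R q (p.*2 - i)) x in [/\ 0 <= z, z <= 1 & up i z = x].
Proof.
move=> ip; have [c0 cb ba b1 d] := hs_abc i ip.
have b0 : 0 < s i.+1 by apply: lt_le_trans b1.
have a0 : 0 < s i.+2 by apply: lt_le_trans ba.
rewrite gkE // /act /= /up /br_up !mulr0 !add0r !mulr1.
rewrite ler_pdivrMr // ler_pdivlMr ?addr_gt0 // => x0 x1.
(* After multiplying the upper bound on x by s(i+2), the determinant identity replaces s(i) s(i+2)
   by s(i+1)^2 - 1, whence the strict sign. *)
have den : 0 < - s i.+2 * x + s i.+1.
  rewrite mulNr addrC subr_gt0 -(ltr_pM2r (addr_gt0 a0 b0)).
  have := ler_wpM2l (ltW a0) x1; lra.
split.
- by rewrite divr_ge0 ?(ltW den) //; lra.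
- by rewrite ler_pdivrMr // mul1r; lra.
(* Cocycle relation: the denominators of g_k at x and of its inverse at g_k.x multiply to the
   determinant 1. *)
- have M1 : s i.+2 * ((s i.+1 * x + - s i) / (- s i.+2 * x + s i.+1)) + s i.+1 =
      (- s i.+2 * x + s i.+1)^-1.
    by rewrite -[RHS]mul1r -d; field; rewrite gt_eqF.
  rewrite M1 invrK -[RHS]mul1r -d; field; by rewrite gt_eqF.
Qed.

Lemma down_inv i x : (i < p)%N -> down i 1 <= x -> x <= down i 0 ->
  let z := act (mmul (Qm R) (gk R q (p.*2 - i))) x in
  [/\ 0 <= z, z <= 1 & down i z = x].
Proof.
move=> ip; have [c0 cb ba b1 d] := hs_abc i ip.
have b0 : 0 < s i.+1 by apply: lt_le_trans b1.
have a0 : 0 < s i.+2 by apply: lt_le_trans ba.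
rewrite gkE // /act /= /down /br_down !mulr0 !add0r !mulr1 !mul0r !mul1r !add0r !addr0.
rewrite ler_pdivrMr ?addr_gt0 // ler_pdivlMr // => x1 x0.
have den : 0 < s i.+1 * x + - s i.
  rewrite subr_gt0 -(ltr_pM2r (addr_gt0 b0 a0)).
  have := ler_wpM2l (ltW b0) x1; lra.
split.
- by rewrite divr_ge0 ?(ltW den) //; lra.
- by rewrite ler_pdivrMr // mul1r; lra.
- have M1 : s i.+1 * ((- s i.+2 * x + s i.+1) / (s i.+1 * x + - s i)) + s i.+2 =
      (s i.+1 * x + - s i)^-1.
    by rewrite -[RHS]mul1r -d; field; rewrite gt_eqF.
  rewrite M1 invrK -[RHS]mul1r -d; field; by rewrite gt_eqF.
Qed.


Lemma mem_Kset k : k \in Kset q -> exists2 i, (i < p)%N & k = (p.*2 - i)%N.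
Proof.
rewrite mem_filter mem_iota /q => H; exists (p.*2 - k)%N; lia.
Qed.

Lemma Kset_mem i : (i < p)%N -> (p.*2 - i)%N \in Kset q.
Proof. by move=> ip; rewrite mem_filter mem_iota /q; lia. Qed.

(** The points r 0 = 0 <= ... <= r p = 1 cut [0, 1] into pieces; on [r i, r (i+1)] the map rises
    from 0 to 1 along g_k and falls back to 0 along Q g_k. *)
Let r (i : nat) := s i / s i.+1.

Lemma up0E i : up i 0 = r i. Proof. by rewrite /up /br_up !mulr0 !add0r. Qed.
Lemma down0E i : down i 0 = r i.+1. Proof. by rewrite /down /br_down !mulr0 !add0r. Qed.

Lemma r_le i j : (i <= j)%N -> (j <= p)%N -> r i <= r j.
Proof.
move=> /subnK <-; elim: (j - i)%N => [|k IH] jp; first by rewrite add0n.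
rewrite addSn in jp *; apply: le_trans (IH (ltnW jp)) _.
have [c0 cb ba b1 d] := hs_abc (k + i) jp.
rewrite /r ler_pdiv2; last 2 first.
- exact: lt_le_trans ltr01 b1.
- exact: lt_le_trans ltr01 (le_trans b1 ba).
by rewrite -expr2 -subr_ge0 d.
Qed.

Lemma r_p : r p = 1.
Proof.
have pp : (p.-1 < p)%N by rewrite prednK.
have [_ _ _ h _] := hs_abc p.-1 pp; rewrite prednK // in h.
by rewrite /r /s hsn_end // divff // gt_eqF // (lt_le_trans ltr01).
Qed.

Lemma r_cover x m : 0 <= x -> (0 < m)%N -> x <= r m ->
  exists i, [/\ (i < m)%N, r i <= x & x <= r i.+1].
Proof.
move=> x0; elim: m => // m IH _ xm.
have [xm'|xm'] := leP x (r m); last by exists m; rewrite ltnSn ltW.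
case: m IH xm xm' => [|m] IH xm xm'.
  by exists 0%N; split => //; rewrite /r /s hsn0 mul0r.
by have [i [im h1 h2]] := IH isT xm'; exists i; split => //; apply: ltnW.
Qed.

Lemma up_at1 i : (i < p)%N -> up i 1 = down i 1.
Proof. by move=> ip; rewrite /up /down /br_up /br_down !mulr1 addrC [X in _ / X]addrC. Qed.

(** The definition of [farey] is unfolded here; from now on it is known through its inverse
    branches. *)
Lemma farey_spec x : 0 <= x -> x <= 1 ->
  [/\ 0 <= farey q x, farey q x <= 1 &
   exists2 i, (i < p)%N & (up i (farey q x) = x \/ down i (farey q x) = x)].
Proof.
move=> x0 x1.
pose good_image z := [/\ 0 <= z, z <= 1 &
   exists2 i, (i < p)%N & (up i z = x \/ down i z = x)].
rewrite -/(good_image _) /farey /branches.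
apply: (first_match_ind _ _ (Kset q)
  (fun k => (gk R q k, act (Defs.pinv (gk R q k)) 0, act (Defs.pinv (gk R q k)) 1))
  (fun k => (mmul (Qm R) (gk R q k), act (Defs.pinv (mmul (Qm R) (gk R q k))) 1,
             act (Defs.pinv (mmul (Qm R) (gk R q k))) 0))
  (fun b => (b.1.2 <= x) && (x <= b.2)) (fun b => act b.1.1 x) x good_image) => /=.
- move=> k /mem_Kset[i ip ->]; rewrite !act_up // => /andP[h1 h2].
  have [z0 z1 E] := up_inv i x ip h1 h2.
  by split => //; exists i => //; left.
- move=> k /mem_Kset[i ip ->]; rewrite !act_down // => /andP[h1 h2].
  have [z0 z1 E] := down_inv i x ip h1 h2.
  by split => //; exists i => //; right.
- have [i [ip h1 h2]] := r_cover x p x0 p_gt0 (eq_ind_r (fun y => x <= y) x1 r_p).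
  exists (p.*2 - i)%N; first exact: Kset_mem.
  rewrite !act_up // !act_down // up0E down0E h1 h2 -up_at1 //= andbT.
  exact: le_total.
Qed.

Lemma up_lt i y z : (i < p)%N -> 0 <= y -> y < z -> up i y < up i z.
Proof.
move=> ip y0 yz; have [c0 cb ba b1 d] := hs_abc i ip.
have b0 : 0 < s i.+1 by apply: lt_le_trans b1.
have a0 : 0 < s i.+2 by apply: lt_le_trans ba.
have My : 0 < s i.+2 * y + s i.+1 by rewrite ltr_wpDl // mulr_ge0 // ltW.
have Mz : 0 < s i.+2 * z + s i.+1.
  by rewrite ltr_wpDl // mulr_ge0 // ltW // (le_lt_trans y0).
rewrite /up /br_up ltr_pdivrMr // [ltRHS]mulrAC ltr_pdivlMr // -subr_gt0.
rewrite [X in 0 < X](_ : _ = (z - y) * (s i.+1 ^+ 2 - s i * s i.+2)); last by ring.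
by rewrite d mulr1 subr_gt0.
Qed.

Lemma down_lt i y z : (i < p)%N -> 0 <= y -> y < z -> down i z < down i y.
Proof.
move=> ip y0 yz; have [c0 cb ba b1 d] := hs_abc i ip.
have b0 : 0 < s i.+1 by apply: lt_le_trans b1.
have a0 : 0 < s i.+2 by apply: lt_le_trans ba.
have My : 0 < s i.+1 * y + s i.+2 by rewrite ltr_wpDl // mulr_ge0 // ltW.
have Mz : 0 < s i.+1 * z + s i.+2.
  by rewrite ltr_wpDl // mulr_ge0 // ltW // (le_lt_trans y0).
rewrite /down /br_down ltr_pdivrMr // [ltRHS]mulrAC ltr_pdivlMr // -subr_gt0.
rewrite [X in 0 < X](_ : _ = (z - y) * (s i.+1 ^+ 2 - s i * s i.+2)); last by ring.
by rewrite d mulr1 subr_gt0.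
Qed.

Lemma up_le_down i y : (i < p)%N -> 0 <= y -> y <= 1 -> up i y <= down i y.
Proof.
by apply: (br_up_le_down R p s (hsn0 R p) (hsn1 R p p_gt0) (hsn_mono R p p_gt0) (hsn_det R p p_gt0)).
Qed.

Lemma up_ge i y : (i < p)%N -> 0 <= y -> r i <= up i y.
Proof.
move=> ip; rewrite le_eqVlt => /orP[/eqP <-|y0]; first by rewrite up0E.
by rewrite -up0E ltW // up_lt.
Qed.

Lemma down_le i y : (i < p)%N -> 0 <= y -> down i y <= r i.+1.
Proof.
move=> ip; rewrite le_eqVlt => /orP[/eqP <-|y0]; first by rewrite down0E.
by rewrite -down0E ltW // down_lt.
Qed.

Lemma branch_bounds i y : (i < p)%N -> 0 <= y -> y <= 1 ->
  [/\ 0 <= up i y, up i y <= down i y & down i y <= 1].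
Proof.
move=> ip y0 y1; split; last 2 first.
- exact: up_le_down.
- by apply: (le_trans (down_le i y ip y0)); rewrite -r_p r_le.
apply: (le_trans _ (up_ge i y ip y0)).
by have := r_le 0 i (leq0n i) (ltnW ip); rewrite {1}/r /s hsn0 mul0r.
Qed.

Lemma branch_lt i j y : (i < j)%N -> (j < p)%N -> 0 <= y -> down i y <= up j y.
Proof.
move=> ij jp y0; apply: (le_trans (down_le i y (ltn_trans ij jp) y0)).
by apply: (le_trans _ (up_ge j y jp y0)); apply: r_le => //; exact: ltnW.
Qed.

(** On each piece [r i, r (i+1)] the graph is a single peak, so a superlevel set is one open
    interval. This description yields both measurability and the recursion for masses. *)
Lemma farey_gt x y : 0 <= x -> x <= 1 -> 0 <= y -> y <= 1 ->
  y < farey q x <-> exists2 i, (i < p)%N & up i y < x /\ x < down i y.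
Proof.
move=> x0 x1 y0 y1; have [z0 z1 [i ip zx]] := farey_spec x x0 x1.
split=> [yz|[j jp [h1 h2]]].
  exists i => //; case: zx => <-; split.
  - exact: up_lt.
  - by apply: (le_lt_trans (up_le_down i _ ip z0 z1)); apply: down_lt.
  - by apply: (lt_le_trans _ (up_le_down i _ ip z0 z1)); apply: up_lt.
  - exact: down_lt.
rewrite ltNge; apply/negP => zy.
have up_hom k : (k < p)%N -> up k (farey q x) <= up k y.
  move=> kp; move: zy; rewrite le_eqVlt => /orP[/eqP ->|zy]; first exact: lexx.
  by rewrite ltW // up_lt.
have down_hom k : (k < p)%N -> down k y <= down k (farey q x).
  move=> kp; move: zy; rewrite le_eqVlt => /orP[/eqP ->|zy]; first exact: lexx.
  by rewrite ltW // down_lt.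
have xl : x <= r i.+1.
  case: zx => <-; last exact: down_le.
  by apply: (le_trans (up_le_down i _ ip z0 z1)); exact: down_le.
have xg : r i <= x.
  case: zx => <-; first exact: up_ge.
  by apply: (le_trans (up_ge i _ ip z0)); exact: up_le_down.
case: (ltngtP i j) => [ij|ji|ij].
- have := le_lt_trans (le_trans (r_le i.+1 j ij (ltnW jp)) (up_ge j y jp y0)) h1.
  by rewrite ltNge xl.
- have := lt_le_trans h2 (le_trans (down_le j y jp y0) (r_le j.+1 i ji (ltnW ip))).
  by rewrite ltNge xg.
- subst j; case: zx => E.
    by have := up_hom i ip; rewrite E leNgt h1.
  by have := down_hom i ip; rewrite E leNgt h2.
Qed.

End FareySpec.

(** * Pushing Lebesgue densities forward *)

Section FareyMeasure.
Variables (R : realType) (p : nat).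
Hypothesis p_gt0 : (0 < p)%N.
Let q := p.*2.+1.
Let s : nat -> R := hsn R p.
Let up := br_up R s.
Let down := br_down R s.
Let F : R -> R := farey q.
Let D : set R := `[0, 1].
Let P (n : nat) (B : set R) : set R := farey_preimage q n B.
Let mu := @lebesgue_measure R.

Lemma iter_farey01 n (x : R) : 0 <= x -> x <= 1 ->
  0 <= iter n F x /\ iter n F x <= 1.
Proof.
move=> x0 x1; elim: n => // n [y0 y1]; rewrite iterS.
by have [] := farey_spec R p p_gt0 _ y0 y1.
Qed.

Lemma mem_preimage n (B : set R) x :
  P n B x <-> [/\ 0 <= x, x <= 1 & B (iter n F x)].
Proof.
rewrite /P /farey_preimage /= inE /= in_itv /=.
by split=> [[/andP[x0 x1] Bx]|[x0 x1 Bx]] //; rewrite x0 x1.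
Qed.

Lemma preimageE n (B : set R) : P n B = D `&` iter n F @^-1` B.
Proof. by apply/seteqP; split => x; rewrite /P /farey_preimage /= inE. Qed.

Lemma preimageU n (A B : set R) : P n (A `|` B) = P n A `|` P n B.
Proof.
apply/seteqP; split => x; rewrite /= ?mem_preimage.
  by move=> [x0 x1 [Ax|Bx]]; [left|right].
by move=> [] [x0 x1 Ax]; split => //; [left|right].
Qed.

Lemma sub_preimage n (B : set R) : P n B `<=` D.
Proof. by move=> x /mem_preimage[x0 x1 _]; rewrite /D /= in_itv /= x0. Qed.

Lemma preimage_gt n (y : R) : 0 <= y -> y <= 1 ->
  P n.+1 `]y, +oo[ = \bigcup_(i < p) P n `]up i y, down i y[.
Proof.
move=> y0 y1; apply/seteqP; split => x /=.
  move=> /mem_preimage[x0 x1]; have [z0 z1] := iter_farey01 n x x0 x1.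
  rewrite iterS /= in_itv /= andbT => /(farey_gt R p p_gt0 _ y z0 z1 y0 y1)[i ip [h1 h2]].
  by exists i => //; apply/mem_preimage; split => //; rewrite /= in_itv /= h1 h2.
move=> [i /= ip /mem_preimage[x0 x1]]; rewrite /= in_itv /= => /andP[h1 h2].
have [z0 z1] := iter_farey01 n x x0 x1.
apply/mem_preimage; split => //; rewrite iterS /= in_itv /= andbT.
by apply/(farey_gt R p p_gt0 _ y z0 z1 y0 y1); exists i.
Qed.

(** Rays generate the Borel sets, and [preimage_gt] reduces a ray at time n + 1 to intervals at time
    n. Thresholds outside [0, 1] give all of [0, 1] or nothing. *)
Lemma measurable_preimage n (B : set R) : measurable B -> measurable (P n B).
Proof.
have mD : measurable D by exact: measurable_itv.
elim: n B => [|n IH] B mB.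
  by rewrite preimageE; exact: measurableI.
have mF : measurable_fun D (iter n.+1 F).
  move=> _; apply: (measurability _ (measurable_realfun.RGenOInfty.measurableE R)) => //.
  move=> /= _ [_ [y ->] <-].
  rewrite -preimageE; have [y0|y0] := ltP y 0.
    rewrite (_ : P _ _ = D) //; apply/seteqP; split; first exact: sub_preimage.
    move=> x; rewrite /D /= in_itv /= => /andP[x0 x1]; apply/mem_preimage; split => //.
    have [z0 z1] := iter_farey01 n.+1 x x0 x1.
    by rewrite /= in_itv /= andbT (lt_le_trans y0).
  have [y1|y1] := leP y 1.
    rewrite preimage_gt //; apply: bigcup_measurable => i _; apply: IH.
    exact: measurable_itv.
  rewrite (_ : P _ _ = set0) //; apply/seteqP; split => // x /mem_preimage[x0 x1].
  have [z0 z1] := iter_farey01 n.+1 x x0 x1.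
  by rewrite /= in_itv /= andbT ltNge (le_trans z1) // ltW.
by rewrite preimageE; exact: mF.
Qed.

(** Preimages of points are therefore null sets, which allows open and closed intervals to be
    exchanged. *)
Lemma finite_preimage1 n (z : R) : finite_set (P n [set z]).
Proof.
elim: n z => [|n IH] z.
  by apply: (@sub_finite_set _ _ [set z]) => // x /mem_preimage[].
apply: (@sub_finite_set _ _ (\bigcup_(i < p) (P n [set up i z] `|` P n [set down i z]))).
  move=> x /mem_preimage[x0 x1 /= E].
  have [y0 y1] := iter_farey01 n x x0 x1.
  have [_ _ [i ip h]] := farey_spec R p p_gt0 _ y0 y1.
  have {}h : up i z = iter n F x \/ down i z = iter n F x by rewrite -E.
  by exists i => //; case: h => h; [left|right]; apply/mem_preimage.
by apply: bigcup_finite => // i _; rewrite finite_setU; split; exact: IH.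
Qed.

(** * Masses of preimages through distribution functions *)

Section Integral.
Variable f : R -> R.
Hypothesis f_int : mu.-integrable D (EFin \o f).

Let nu n (B : set R) := Rintegral mu (P n B) f.

Lemma integrable_preimage n (B : set R) : measurable B ->
  mu.-integrable (P n B) (EFin \o f).
Proof.
move=> mB; apply: integrableS f_int; first exact: measurable_itv.
  exact: measurable_preimage.
exact: sub_preimage.
Qed.

Lemma nuU n (A B : set R) : measurable A -> measurable B -> A `&` B = set0 ->
  nu n (A `|` B) = nu n A + nu n B.
Proof.
move=> mA mB AB; rewrite /nu preimageU Rintegral_setU //.
- exact: measurable_preimage.
- exact: measurable_preimage.
- by rewrite -preimageU; apply: integrable_preimage; exact: measurableU.
- apply/disj_setPS => x [/mem_preimage[_ _ Ax] /mem_preimage[_ _ Bx]].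
  by have : (A `&` B) (iter n F x) by []; rewrite AB.
Qed.

Lemma nu1 n (z : R) : nu n [set z] = 0.
Proof.
have fin := finite_preimage1 n z.
rewrite /nu /Rintegral null_set_integral //.
- exact: measurable_preimage.
- exact: (measurable_int mu (integrable_preimage n [set z] (measurable_set1 z))).
- exact/countable_lebesgue_measure0/finite_set_countable.
Qed.

Let V n (y : R) := nu n `]y, +oo[.

Lemma nu_oo n (u d : R) : u <= d -> nu n `]u, d[ = V n u - V n d.
Proof.
rewrite le_eqVlt => /orP[/eqP <-|ud].
  rewrite set_itvoo0 subrr /nu (_ : P n set0 = set0) ?Rintegral_set0 //.
  by apply/seteqP; split => // x /mem_preimage[].
have E : `]u, +oo[%classic = `]u, d[ `|` ([set d] `|` `]d, +oo[) :> set R.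
  apply/seteqP; split => x /=; rewrite !in_itv /= !andbT.
    by move=> ux; case: (ltgtP x d) => h; [left; rewrite ux|right; right|right; left].
  by move=> [/andP[]|[->|/(lt_trans ud)]].
rewrite /V E nuU; [|exact: measurable_itv| |]; last 2 first.
- by apply: measurableU => //; exact: measurable_itv.
- apply/seteqP; split => // x /= []; rewrite !in_itv /= andbT => /andP[_ xd] [E'|dx].
    by rewrite E' ltxx in xd.
  by have := lt_trans xd dx; rewrite ltxx.
rewrite nuU; [|exact: measurable_set1|exact: measurable_itv|]; last first.
  by apply/seteqP; split => // x /= [->]; rewrite in_itv /= ltxx.
by rewrite nu1 add0r addrK.
Qed.

Lemma nu_cc n (u d : R) : u <= d -> nu n `[u, d] = V n u - V n d.
Proof.
move=> ud; apply/eqP; rewrite eq_sym subr_eq; apply/eqP.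
rewrite /V -nuU; [|exact: measurable_itv|exact: measurable_itv|]; last first.
  apply/seteqP; split => // x /= []; rewrite !in_itv /= andbT => /andP[_ xd] dx.
  by have := lt_le_trans dx xd; rewrite ltxx.
rewrite -[LHS]add0r -(nu1 n u) -nuU; [|exact: measurable_set1|exact: measurable_itv|]; last first.
  by apply/seteqP; split => // x /= [->]; rewrite in_itv /= ltxx.
congr (nu n _); apply/seteqP; split => x /=; rewrite !in_itv /= !andbT.
  move=> [->|ux]; first by left; rewrite lexx.
  by case: (leP x d) => h; [left; rewrite ltW|right].
move=> [/andP[]|dx]; last by right; exact: le_lt_trans dx.
by rewrite le_eqVlt => /orP[/eqP ->|]; [left|right].
Qed.

Lemma nu_bigcup n m (A : nat -> set R) : (forall i, measurable (A i)) ->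
  (forall i j x, (i < j)%N -> (j < m)%N -> A i x -> A j x -> False) ->
  Rintegral mu (\bigcup_(i < m) P n (A i)) f = \sum_(i < m) nu n (A i).
Proof.
move=> mA tA.
suff : nu n (\bigcup_(i < m) A i) = \sum_(i < m) nu n (A i).
  move=> <-; rewrite /nu; congr (Rintegral mu _ f).
  apply/seteqP; split => x.
    by move=> [i im /mem_preimage[x0 x1 Ax]]; apply/mem_preimage; split => //; exists i.
  by move=> /mem_preimage[x0 x1 [i im Ax]]; exists i => //; apply/mem_preimage.
elim: m tA => [|m IH] tA.
  rewrite big_ord0 bigcup_mkord big_ord0 /nu (_ : P n set0 = set0) ?Rintegral_set0 //.
  by apply/seteqP; split => // x /mem_preimage[].
rewrite big_ord_recr /= -IH; last by move=> i j x ij jm; apply: tA => //; exact: ltnW.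
rewrite -nuU //; last 2 first.
- exact: bigcup_measurable.
- apply/seteqP; split => // x [[i /= im Ai] Am]; exact: (tA i m x im (ltnSn m) Ai Am).
by rewrite !bigcup_mkord big_ord_recr.
Qed.

Variable U0 : R -> R.
Hypothesis U0_primitive : forall y, 0 <= y -> y <= 1 -> V 0 y = U0 1 - U0 y.

(** Here the measure meets the analytic recursion. Masses above y are used because [preimage_gt]
    splits exactly these, and [push_cdf] preserves the total mass. *)
Lemma V_push_cdf n (y : R) : 0 <= y -> y <= 1 ->
  V n y = iter n (push_cdf R p s) U0 1 - iter n (push_cdf R p s) U0 y.
Proof.
elim: n y => [|n IH] y y0 y1; first exact: U0_primitive.
rewrite {1}/V {1}/nu preimage_gt // nu_bigcup; last 2 first.
- by move=> i; exact: measurable_itv.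
- move=> i j x ij jp /=; rewrite !in_itv /= => /andP[_ h1] /andP[h2 _].
  have := branch_lt R p p_gt0 i j y ij jp y0; rewrite leNgt => /negP; apply.
  exact: lt_trans h2 h1.
rewrite !iterS (push_cdf_1 R p s) /push_cdf opprD addrA subrr add0r -sumrN.
apply: eq_bigr => -[i ip] _ /=.
have [u0 ud d1] := branch_bounds R p p_gt0 i y ip y0 y1.
rewrite nu_oo // !IH //; last 2 first.
- exact: le_trans u0 ud.
- exact: le_trans ud d1.
by rewrite /up /down; ring.
Qed.

Lemma Rintegral_farey_preimage n (a b : R) : 0 <= a -> a <= b -> b <= 1 ->
  Rintegral mu (farey_preimage q n `[a, b]) f =
  iter n (push_cdf R p s) U0 b - iter n (push_cdf R p s) U0 a.
Proof.
move=> a0 ab b1; have := nu_cc n a b ab; rewrite /nu /P => ->.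
by rewrite V_push_cdf ?(le_trans ab) // V_push_cdf ?(le_trans a0) //; ring.
Qed.

End Integral.
End FareyMeasure.

(** * Polynomial approximation *)

Section Bernstein.
Variable R : realType.

(* The Bernstein polynomial of the values [phi 0, ..., phi n], i.e. the expectation
   of [phi] under the binomial law, by conditioning on the first trial. *)
Fixpoint bernstein (n : nat) (phi : nat -> R) : {poly R} :=
  if n is m.+1 then
    'X * bernstein m (fun k => phi k.+1) + (1 - 'X) * bernstein m phi
  else (phi 0%N)%:P.

Lemma bernsteinS n phi x : (bernstein n.+1 phi).[x] =
  x * (bernstein n (fun k => phi k.+1)).[x] + (1 - x) * (bernstein n phi).[x].
Proof. by rewrite /= !hornerE. Qed.

Lemma bernstein_le n (phi psi : nat -> R) x : 0 <= x -> x <= 1 ->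
  (forall k, (k <= n)%N -> phi k <= psi k) ->
  (bernstein n phi).[x] <= (bernstein n psi).[x].
Proof.
move=> x0 x1; elim: n phi psi => [|n IH] phi psi h.
  by rewrite /= !hornerE h.
rewrite !bernsteinS lerD // ler_wpM2l ?subr_ge0 // IH // => k kn; apply: h => //.
exact: leqW.
Qed.

Lemma bernstein_affine n (phi : nat -> R) (c d : R) x :
  (bernstein n (fun k => c * phi k + d)).[x] = c * (bernstein n phi).[x] + d.
Proof.
elim: n phi => [|n IH] phi; first by rewrite /= !hornerE.
by rewrite !bernsteinS !IH; ring.
Qed.

(** The centre t is arbitrary because conditioning on the first trial shifts it to t - 1; at t = n x
    this is the binomial variance. *)
Lemma bernstein_variance n (t x : R) :
  (bernstein n (fun k => (k%:R - t) ^+ 2)).[x] =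
  n%:R * x * (1 - x) + (n%:R * x - t) ^+ 2.
Proof.
elim: n t => [|n IH] t; first by rewrite /= hornerC; ring.
rewrite bernsteinS IH.
have -> : (fun k : nat => (k.+1%:R - t) ^+ 2) = (fun k : nat => (k%:R - (t - 1)) ^+ 2).
  by apply/funext => k; rewrite -natr1; congr (_ ^+ 2); ring.
by rewrite IH -natr1; ring.
Qed.

(** With a quadratic modulus the error is bounded by the expectation of e + C (k/N - x)^2, which the
    variance evaluates directly, without splitting the sum into near and far terms. *)
Lemma bernstein_approx (f : R -> R) (e C : R) (n : nat) (x : R) :
  (forall x y, 0 <= x -> x <= 1 -> 0 <= y -> y <= 1 ->
     `|f x - f y| <= e + C * (x - y) ^+ 2) ->
  0 <= C -> 0 <= x -> x <= 1 ->
  `|f x - (bernstein n.+1 (fun k => f (k%:R / n.+1%:R))).[x]| <= e + C / n.+1%:R.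
Proof.
move=> H C0 x0 x1; set N := n.+1%:R : R.
have N0 : 0 < N by rewrite ltr0n.
have M0 := gt_eqF N0.
pose phi k := C / N ^+ 2 * (k%:R - N * x) ^+ 2 + e.
have E : (bernstein n.+1 phi).[x] <= e + C / N.
  rewrite bernstein_affine bernstein_variance subrr expr0n addr0 addrC lerD2l.
  have -> : C / N ^+ 2 * (n.+1%:R * x * (1 - x)) = C / N * (x * (1 - x)).
    rewrite -/N; move: (N) M0 => M M0; by field; rewrite M0.
  rewrite -[leRHS]mulr1 ler_wpM2l ?divr_ge0 ?(ltW N0) //.
  by rewrite -[leRHS]mul1r ler_pM ?subr_ge0 // gerBl.
have K k : (k <= n.+1)%N -> `|f x - f (k%:R / N)| <= phi k.
  move=> kn.
  have k0 : 0 <= k%:R / N by rewrite divr_ge0 // ltW.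
  have k1 : k%:R / N <= 1 by rewrite ler_pdivrMr // mul1r ler_nat.
  apply: (le_trans (H x (k%:R / N) x0 x1 k0 k1)).
  rewrite addrC lerD2r.
  have -> : C * (x - k%:R / N) ^+ 2 = C / N ^+ 2 * (k%:R - N * x) ^+ 2.
    by move: (N) M0 => M M0'; field; rewrite M0'.
  exact: lexx.
set psi := fun k : nat => f (k%:R / N).
apply: le_trans E; rewrite ler_norml; apply/andP; split.
- have : (bernstein n.+1 psi).[x] <= (bernstein n.+1 (fun k => 1 * phi k + f x)).[x].
    apply: bernstein_le => // k kn.
    by have := K k kn; rewrite -/(psi k) ler_norml => /andP[h _]; lra.
  by rewrite bernstein_affine; lra.
- have : (bernstein n.+1 (fun k => (-1) * phi k + f x)).[x] <= (bernstein n.+1 psi).[x].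
    apply: bernstein_le => // k kn.
    by have := K k kn; rewrite -/(psi k) ler_norml => /andP[_ h]; lra.
  by rewrite bernstein_affine; lra.
Qed.

Lemma continuous_modulus (f : R -> R) (e : R) : 0 < e ->
  {within `[0, 1], continuous f} ->
  exists2 C, 0 <= C & forall x y, 0 <= x -> x <= 1 -> 0 <= y -> y <= 1 ->
    `|f x - f y| <= e + C * (x - y) ^+ 2.
Proof.
move=> e0 cf.
have [M M0 fM] : exists2 M, 0 <= M & forall x, 0 <= x -> x <= 1 -> `|f x| <= M.
  have [a _ fa] := EVT_max (@ler01 R) cf; have [b _ fb] := EVT_min (@ler01 R) cf.
  exists (`|f a| + `|f b|) => [|x x0 x1]; first by rewrite addr_ge0.
  have xI : x \in `[0, 1]%R by rewrite in_itv /= x0.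
  have := fa x xI; have := fb x xI; have := ler_norm (f a); have := ler_norm (- f b).
  have := normr_ge0 (f a); have := normr_ge0 (f b).
  rewrite normrN ler_norml => *; apply/andP; split; lra.
have K : compact (`[0, 1]%classic : set R) by exact: segment_compact.
pose good C x := 0 <= x -> x <= 1 -> forall y, 0 <= y -> y <= 1 ->
    `|f x - f y| <= e + C * (x - y) ^+ 2.
have H : \forall C \near +oo, `[0, 1]%classic `<=` good C.
  apply: ((compact_near_coveringP _).1 K) => z /= zI.
  have /subspace_continuousP/(_ z zI)/cvgrPdist_lt/(_ (e / 2)) := cf.
  move=> /(_ (divr_gt0 e0 (ltr0Sn _ _))); rewrite near_withinE => -[d /= d0 Hd].
  (* For x within d/2 of z, either y is within d of z and continuity applies twice, or |x - y| >=
     d/2 and C (x - y)^2 >= 2 M bounds any oscillation. *)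
  exists (ball z (d / 2), [set C | 2 * M / (d / 2) ^+ 2 <= C]).
    split; first by apply: nbhsx_ballx; rewrite divr_gt0.
    by apply: nbhs_pinfty_ge; rewrite num_real.
  move=> [x C] /= [xz CM] x0 x1 y y0 y1; rewrite /= in xz CM.
  have d2 : 0 < (d / 2) ^+ 2 by rewrite exprn_gt0 // divr_gt0.
  have C0 : 0 <= C by apply: le_trans CM; rewrite divr_ge0 ?mulr_ge0 // ltW.
  have xz' : `|z - x| < d / 2 by [].
  have sq : 0 <= C * (x - y) ^+ 2 by rewrite mulr_ge0 // sqr_ge0.
  have [yz|yz] := ltP `|z - y| d.
    have hx : `|f z - f x| < e / 2.
      by apply: Hd; rewrite /= ?in_itv /= ?x0 //; apply: lt_trans xz' _; lra.
    have hy : `|f z - f y| < e / 2 by apply: Hd; rewrite /= ?in_itv /= ?y0.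
    have -> : f x - f y = - (f z - f x) + (f z - f y) by ring.
    apply: (le_trans (ler_normD _ _)); rewrite normrN; lra.
  have xy : d / 2 <= `|x - y|.
    have : `|z - y| <= `|z - x| + `|x - y|.
      by rewrite (_ : z - y = (z - x) + (x - y)) ?ler_normD //; ring.
    lra.
  have : 2 * M <= C * (x - y) ^+ 2.
    rewrite ler_pdivrMr // in CM; apply: (le_trans CM); rewrite ler_wpM2l //.
    have dd : 0 <= d / 2 by rewrite divr_ge0 // ltW.
    by rewrite -[leRHS]real_normK ?num_real // lerXn2r.
  move=> CM2; apply: (le_trans (ler_normB _ _)).
  apply: (le_trans (lerD (fM x x0 x1) (fM y y0 y1))); lra.
near (pinfty_nbhs R) => C.
exists C => [|x y x0 x1 y0 y1]; first by near: C; apply: nbhs_pinfty_ge; rewrite num_real.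
have Hgood : `[0, 1]%classic `<=` good C by near: C.
by apply: (Hgood x) => //=; rewrite in_itv /= x0.
Unshelve. all: by end_near.
Qed.

Lemma weierstrass (f : R -> R) (e : R) : 0 < e ->
  {within `[0, 1], continuous f} ->
  exists P : {poly R}, forall x, 0 <= x -> x <= 1 -> `|f x - P.[x]| <= e.
Proof.
move=> e0 cf; have e2 : 0 < e / 2 by rewrite divr_gt0.
have [C C0 H] := continuous_modulus f (e / 2) e2 cf.
pose n := Num.truncn (C / (e / 2)).
exists (bernstein n.+1 (fun k => f (k%:R / n.+1%:R))) => x x0 x1.
apply: (le_trans (bernstein_approx f (e / 2) C n x H C0 x0 x1)).
have : C / n.+1%:R <= e / 2.
  by rewrite ler_pdivrMr ?ltr0n // mulrC -ler_pdivrMr // ltW // truncnS_gt.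
by move=> h; rewrite [leRHS](splitr e) lerD2l.
Qed.

End Bernstein.

(** * The limit law *)

Section Polynomials.
Variable R : realType.

Lemma poly_bounded (P : {poly R}) :
  exists2 B, 0 <= B & forall x, 0 <= x -> x <= 1 -> `|P.[x]| <= B.
Proof.
elim/poly_ind: P => [|P c [B B0 IH]].
  by exists 0 => // x _ _; rewrite horner0 normr0.
exists (B + `|c|) => [|x x0 x1]; first by rewrite addr_ge0.
rewrite !hornerE (le_trans (ler_normD _ _)) // lerD2r normrM (ger0_norm x0).
by apply: le_trans (IH x x0 x1); rewrite -[leRHS]mulr1 ler_wpM2l.
Qed.

Lemma poly_primitive (P : {poly R}) : exists2 Q : {poly R}, Q^`() = P & Q.[0] = 0.
Proof.
exists (\sum_(i < size P) (P`_i / i.+1%:R) *: 'X^(i.+1)).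
  rewrite raddf_sum -[RHS]coefK poly_def; apply: eq_bigr => i _.
  by rewrite /= derivZ derivXn -['X^_ *+ _]scaler_nat scalerA divfK ?pnatr_eq0.
rewrite horner_sum big1 // => i _.
by rewrite hornerZ hornerXn expr0n /= mulr0.
Qed.

Lemma continuous_poly (P : {poly R}) (A : set R) : {within A, continuous (horner P)}.
Proof. exact/continuous_subspaceT/continuous_horner. Qed.

Lemma Rintegral_poly (P : {poly R}) (a b : R) : a <= b ->
  Rintegral (@lebesgue_measure R) `[a, b] (horner P^`()) = P.[b] - P.[a].
Proof.
rewrite le_eqVlt => /orP[/eqP <-|ab].
  by rewrite set_itv1 Rintegral_set1 subrr.
rewrite /Rintegral (@continuous_FTC2 R (horner P^`()) (horner P)) //.
- exact: continuous_poly.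
- split=> [x _||].
  + exact: derivable_horner.
  + by apply: cvg_at_right_filter; exact: continuous_horner.
  + by apply: cvg_at_left_filter; exact: continuous_horner.
- by move=> x _; rewrite -derivE.
Qed.

(* Adding C * (3 - X) to P adds C * (3 x - x^2) to x * P(x), which is increasing
   and concave on [0, 1]. *)
Lemma poly_concave_incr (P : {poly R}) : exists2 C, 0 <= C & forall t, 0 <= t <= 1 ->
  is_concave_incr R (fun x => ('X * (t *: P + C *: (3%:P - 'X))).[x]).
Proof.
have [B0 B00 h0] := poly_bounded P.
have [B1 B10 h1] := poly_bounded ('X * P)^`().
have [B2 B20 h2] := poly_bounded ('X * P)^`()^`().
(* On [0, 1] one has 3 - x >= 2 and 3 - 2 x >= 1, and (3 x - x^2)'' = -2, so C dominates P and the
   first two derivatives of x P(x). The same C must serve t = 1 and t = 0, whose densities are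
   subtracted in [limit_law_poly]. *)
exists (B0 + B1 + B2) => [|t /andP[t0 t1]]; first by rewrite !addr_ge0.
set C := B0 + B1 + B2; set G := 'X * _.
have GE : G = t *: ('X * P) + C *: ('X * (3%:P - 'X)).
  by rewrite /G mulrDr -!scalerAr.
have D1 : ('X * (3%:P - 'X) : {poly R})^`() = 3%:P - 'X *+ 2.
  by rewrite derivM derivB derivX derivC; ring.
have E1 x : G^`().[x] = t * ('X * P)^`().[x] + C * (3 - 2 * x).
  rewrite GE derivD !derivZ D1 hornerD !hornerZ; congr (_ + _ * _).
  by rewrite !hornerE; ring.
have E2 x : G^`()^`().[x] = t * ('X * P)^`()^`().[x] - 2 * C.
  rewrite GE derivD !derivZ D1 derivD !derivZ hornerD !hornerZ; congr (_ + _).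
  by rewrite derivB derivMn derivX derivC !hornerE; ring.
have bnd (Q : {poly R}) B x : `|Q.[x]| <= B -> - B <= t * Q.[x] <= B.
  move=> h; have B'0 : 0 <= B by apply: le_trans h.
  by rewrite -ler_norml normrM (ger0_norm t0) -[leRHS]mul1r ler_pM.
exists (horner G^`()), (horner G^`()^`()); split=> [y _|y _|y y0 y1].
- exact: is_derive_poly.
- exact: is_derive_poly.
have /andP[b0 _] := bnd _ _ _ (h0 y (ltW y0) y1).
have /andP[b1 _] := bnd _ _ _ (h1 y (ltW y0) y1).
have /andP[_ b2] := bnd _ _ _ (h2 y (ltW y0) y1).
have C0 : 0 <= C by rewrite !addr_ge0.
have Cy : C * y <= C by rewrite -[leRHS]mulr1 ler_wpM2l.
split.
- rewrite /G hornerM hornerX mulr_ge0 ?(ltW y0) // !hornerE.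
  have -> : t * P.[y] + C * (3 - y) = t * P.[y] + 3 * C - C * y by ring.
  by rewrite /C in C0 Cy *; lra.
- rewrite E1.
  have -> : t * ('X * P)^`().[y] + C * (3 - 2 * y) = t * ('X * P)^`().[y] + 3 * C - 2 * (C * y) by ring.
  by rewrite /C in C0 Cy *; lra.
- by rewrite E2 /C; lra.
Qed.

End Polynomials.

Lemma Rintegral_close (d : measure_display) (T : measurableType d) (R : realType)
    (mu : {measure set T -> \bar R}) (A : set T) (f g : T -> R) (e : R) : measurable A ->
  mu.-integrable A (EFin \o f) -> mu.-integrable A (EFin \o g) ->
  mu.-integrable A (EFin \o (fun=> 1 : R)) ->
  (forall x, A x -> `|f x - g x| <= e) ->
  `|Rintegral mu A f - Rintegral mu A g| <= e * Rintegral mu A (fun=> 1).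
Proof.
move=> mA fi gi oi h; rewrite -RintegralB //.
have intZ (k : R) (h' : T -> R) : mu.-integrable A (EFin \o h') ->
    mu.-integrable A (EFin \o (fun x => k * h' x)).
  by move=> ih; have := integrableZl mA k ih; apply: eq_integrable => // x _; rewrite /= EFinM.
have ei := intZ e _ oi.
have di : mu.-integrable A (EFin \o (fun x => f x - g x)).
  by have := integrableB mA fi gi; apply: eq_integrable => // x _; rewrite /= EFinB.
rewrite -RintegralZl // ler_norml; apply/andP; split.
  have -> : - Rintegral mu A (fun=> e * 1) = Rintegral mu A (fun=> -1 * (e * 1)).
    by rewrite [RHS]RintegralZl ?mulN1r.
  apply: le_Rintegral => //; first exact: intZ ei.
  by move=> x /h; rewrite ler_norml => /andP[]; lra.
apply: le_Rintegral => // x /h; rewrite ler_norml => /andP[]; lra.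
Qed.

Section Main.
Variables (R : realType) (p : nat) (a b : R).
Hypothesis p_gt0 : (0 < p)%N.
Hypotheses (a0 : 0 < a) (ab : a <= b) (b1 : b <= 1).
Let q := p.*2.+1.
Let s := hsn R p.
Let mu := @lebesgue_measure R.
Let Pn n : set R := farey_preimage q n `[a, b].
Let I01 : set R := `[0, 1].

Definition limit_law (f : R -> R) :=
  ln n%:R * Rintegral mu (Pn n) f @[n --> \oo] --> ln (b / a) * Rintegral mu I01 f.

Lemma integrable01 (f : R -> R) : {within I01, continuous f} ->
  mu.-integrable I01 (EFin \o f).
Proof. by move=> cf; apply: continuous_compact_integrable => //; exact: segment_compact. Qed.

Lemma integrable_Pn n (f : R -> R) : {within I01, continuous f} ->
  mu.-integrable (Pn n) (EFin \o f).
Proof.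
move=> cf; apply: (integrable_preimage R p p_gt0 _ (integrable01 f cf)).
exact: measurable_itv.
Qed.

Lemma measurable_Pn n : measurable (Pn n).
Proof. by apply: measurable_preimage => //; exact: measurable_itv. Qed.

(** Lebesgue density P means density x P(x) relative to dx/x; the initial distribution function is
    the primitive Q with Q(0) = 0, of total mass Q(1). *)
Lemma limit_law_concave_incr (P : {poly R}) : is_concave_incr R (fun x => ('X * P).[x]) ->
  limit_law (horner P).
Proof.
move=> G; have [Q QP Q0] := poly_primitive R P.
have UG : cdf_of R (horner Q) (fun x => ('X * P).[x]).
  split=> // y y0; apply: (is_derive_eq (is_derive_poly Q y)).
  by rewrite QP hornerM hornerX mulrAC divff ?mul1r // gt_eqF.
have orbit1_le n : orbit1 R s n <= n.+1%:R^-1.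
  have h := orbit1_den_gt0 R p s p_gt0 (hsn1 R p p_gt0) (hsn_mono R p p_gt0) n.
  rewrite /orbit1 lef_pV2 ?posrE ?ltr0n // -natr1 addrC lerD2l -[leLHS]mulr1 ler_wpM2l //.
  exact: (s2_ge1 R p s p_gt0 (hsn1 R p p_gt0) (hsn_mono R p p_gt0)).
have U0 : Q.[orbit1 R s n] @[n --> \oo] --> (0 : R).
  have orbit1_cvg : orbit1 R s n @[n --> \oo] --> (0 : R).
    apply: (squeeze_cvgr _ (cvg_cst 0) (@cvg_harmonic R)); apply: nearW => n.
    by rewrite orbit1_le ltW // (orbit1_gt0 R p s p_gt0 (hsn1 R p p_gt0) (hsn_mono R p p_gt0)).
  have := cvg_comp _ _ orbit1_cvg ((@continuous_horner R Q) 0).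
  by rewrite Q0.
have := Un_cvg R p s p_gt0 (hsn0 R p) (hsn1 R p p_gt0) (hsn_mono R p p_gt0)
  (hsn_end R p) (hsn_det R p p_gt0) (hsn2_le2 R p p_gt0) (horner Q) _ UG G U0 a b a0 ab b1.
rewrite /limit_law -QP Rintegral_poly // Q0 subr0.
have -> // : (fun n => ln n%:R * Rintegral mu (Pn n) (horner Q^`())) =
  (fun n => ln n%:R * (iter n (push_cdf R p s) (horner Q) b - iter n (push_cdf R p s) (horner Q) a)).
apply/funext => n; congr (_ * _).
apply: Rintegral_farey_preimage => //; last exact: ltW.
  apply: integrable01; exact: continuous_poly.
move=> y y0 y1; rewrite -Rintegral_poly //.
have sub : `]y, 1]%classic `<=` I01.
  by move=> x; rewrite /I01 /= !in_itv /= => /andP[yx ->]; rewrite (le_trans y0) // ltW.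
have cQ : {within I01, continuous (horner Q^`())} by exact: continuous_poly.
have iQ : mu.-integrable `]y, 1] (EFin \o horner Q^`()).
  apply: integrableS (integrable01 _ cQ); [exact: measurable_itv|exact: measurable_itv|exact: sub].
have <- := @Rintegral_itv_obnd_cbnd R y (BRight 1) (horner Q^`()) iQ.
congr Rintegral; apply/seteqP; split => x; rewrite mem_preimage /= !in_itv /= andbT.
  by move=> [x0 x1 yx]; rewrite yx x1.
by move=> /andP[yx x1]; split => //; rewrite (le_trans y0) // ltW.
Qed.

Lemma limit_law_poly (P : {poly R}) : limit_law (horner P).
Proof.
have [C C0 H] := poly_concave_incr R P.
have H1 := limit_law_concave_incr _ (H 1 _).
have H0 := limit_law_concave_incr _ (H 0 _).
rewrite ler01 lexx in H1; rewrite lexx ler01 in H0.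
have HB := cvgB (H1 isT) (H0 isT); rewrite /limit_law.
have cP (Q : {poly R}) A : {within A, continuous (horner Q)} by exact: continuous_poly.
have E : horner P = (fun x => (1 *: P + C *: (3%:P - 'X)).[x] - (0 *: P + C *: (3%:P - 'X)).[x]).
  by apply/funext => x; rewrite !hornerE; ring.
have E01 : Rintegral mu I01 (horner P) =
    Rintegral mu I01 (horner (1 *: P + C *: (3%:P - 'X))) -
    Rintegral mu I01 (horner (0 *: P + C *: (3%:P - 'X))).
  rewrite {1}E RintegralB //; [exact: measurable_itv|exact: integrable01|exact: integrable01].
have EP n : Rintegral mu (Pn n) (horner P) =
    Rintegral mu (Pn n) (horner (1 *: P + C *: (3%:P - 'X))) -
    Rintegral mu (Pn n) (horner (0 *: P + C *: (3%:P - 'X))).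
  rewrite {1}E RintegralB //; [exact: measurable_Pn|exact: integrable_Pn|exact: integrable_Pn].
rewrite E01 mulrBr.
rewrite (_ : (fun n => _) = (fun n =>
  ln n%:R * Rintegral mu (Pn n) (horner (1 *: P + C *: (3%:P - 'X))) -
  ln n%:R * Rintegral mu (Pn n) (horner (0 *: P + C *: (3%:P - 'X))))).
  exact: HB.
by apply/funext => n; rewrite EP mulrBr.
Qed.

(** A uniform error d in f is amplified by log n, but it is integrated only over the preimage, and
    the law for the constant 1 keeps log n times the measure of that set below L + 1. *)
Lemma limit_law_continuous (f : R -> R) : {within I01, continuous f} -> limit_law f.
Proof.
move=> cf; rewrite /limit_law.
have c1 (A : set R) : {within A, continuous (fun=> 1 : R)}.
  by apply: continuous_subspaceT => x; exact: cvg_cst.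
have law1 : limit_law (fun=> 1).
  have -> : (fun=> 1) = horner (1%:P : {poly R}) by apply/funext => x; rewrite hornerC.
  exact: limit_law_poly.
set L := ln (b / a).
have L0 : 0 <= L by rewrite ln_ge0 // ler_pdivlMr // mul1r.
have I1 : Rintegral mu I01 (fun=> 1) = 1.
  have := Rintegral_poly R 'X 0 1 ler01; rewrite derivX !hornerX subr0 => E.
  by rewrite -[RHS]E; congr Rintegral; apply/funext => x; rewrite hornerE.
rewrite /limit_law I1 mulr1 -/L in law1.
apply/cvgrPdist_le => e e0.
have K0 : 0 < 3 * L + 2 by lra.
(* The errors L d, d and d (L + 1) add up to (2 L + 2) d, which is at most e. *)
pose d := e / (3 * L + 2).
have d0 : 0 < d by rewrite divr_gt0.
have [P fP] := weierstrass R f d d0 cf.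
have lawP := limit_law_poly P; rewrite /limit_law -/L in lawP.
have cP A : {within A, continuous (horner P)} by exact: continuous_poly.
near=> n.
have l0 : 0 <= ln n%:R :> R.
  by rewrite ln_ge0 // ler1n; near: n; exists 1%N.
have m1 : ln n%:R * Rintegral mu (Pn n) (fun=> 1) <= L + 1.
  near: n; move/cvgrPdist_le/(_ 1 ltr01) : law1; apply: filterS => n.
  by rewrite ler_norml => /andP[+ _]; lra.
have m2 : `|L * Rintegral mu I01 (horner P) - ln n%:R * Rintegral mu (Pn n) (horner P)| <= d.
  by near: n; move/cvgrPdist_le/(_ d d0) : lawP.
have h1 : `|Rintegral mu I01 f - Rintegral mu I01 (horner P)| <= d * 1.
  rewrite -[X in d * X]I1; apply: Rintegral_close; try exact: integrable01.
    exact: measurable_itv.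
  by move=> x; rewrite /I01 /= in_itv /= => /andP[x0 x1]; exact: fP.
have h2 : `|Rintegral mu (Pn n) f - Rintegral mu (Pn n) (horner P)| <=
    d * Rintegral mu (Pn n) (fun=> 1).
  apply: Rintegral_close; try exact: integrable_Pn; first exact: measurable_Pn.
  by move=> x /mem_preimage[x0 x1 _]; exact: fP.
set If := Rintegral mu I01 f in h1 *; set IP := Rintegral mu I01 _ in m2 h1.
set Jf := Rintegral mu (Pn n) f in h2 *; set JP := Rintegral mu (Pn n) (horner P) in m2 h2.
set J1 := Rintegral mu (Pn n) (fun=> 1) in m1 h2.
have -> : L * If - ln n%:R * Jf = L * (If - IP) + (L * IP - ln n%:R * JP) - ln n%:R * (Jf - JP) by ring.
apply: (le_trans (ler_normB _ _)).
apply: (@le_trans _ _ ((L * d + d) + d * (L + 1))).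
  apply: lerD.
    apply: (le_trans (ler_normD _ _)); apply: lerD => //.
    by rewrite normrM ger0_norm // ler_wpM2l // -[d]mulr1.
  rewrite normrM ger0_norm //; apply: (le_trans (ler_wpM2l l0 h2)).
  by rewrite mulrCA ler_wpM2l // ltW.
have dE : d * (3 * L + 2) = e by rewrite /d divfK // gt_eqF.
have : 0 <= d * L by rewrite mulr_ge0 // ltW.
lra.
Unshelve. all: by end_near.
Qed.

End Main.

Theorem theorem1p1 (R : realType) (q : nat) (alpha beta : R) :
  (5 <= q)%N -> odd q -> 0 < alpha -> alpha <= beta -> beta <= 1 ->
  forall f : R -> R, {within `[0, 1]%classic, continuous f} ->
  (fun n : nat => ln (n%:R : R) *
      Rintegral lebesgue_measure (farey_preimage q n `[alpha, beta]%classic) f)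
    @ \oo --> ln (beta / alpha) * Rintegral lebesgue_measure `[0, 1]%classic f.
Proof.
move=> q5 oq a0 ab b1 f cf.
have p0 : (0 < q./2)%N by lia.
have -> : q = (q./2).*2.+1 by lia.
exact: limit_law_continuous.
Qed.
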